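(* For every $c\in\mathbb{C}\setminus\{0\}$ there exists a constant $0<K<\infty$, depending only on $c$, such that the following holds. Let $A$ be an analytic function in $\mathbb{D}$ and let $f_1,f_2\in\mathcal{B}$ be linearly independent solutions of the differential equation $f''+Af=0$ whose (constant, non-zero) Wronskian determinant is $f_1f_2'-f_1'f_2=c$. Then $$\sup_{z\in\mathbb{D}}|A(z)|(1-|z|^2)^{5/2}\leq K\max\{\|f_1\|_{\mathcal{B}},\|f_2\|_{\mathcal{B}}\}<\infty.$$
   Context: $\mathbb{D}=\{z\in\mathbb{C}:|z|<1\}$ is the open unit disc. The Bloch space $\mathcal{B}$ consists of all functions $f$ analytic in $\mathbb{D}$ with $\|f\|_{\mathcal{B}}=\sup_{z\in\mathbb{D}}|f'(z)|(1-|z|^2)<\infty$ (a seminorm). The Wronskian determinant of two solutions of $f''+Af=0$ is constant, and it is non-zero precisely when the solutions are linearly independent. *)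

(* Defs.v *)
From Stdlib Require Import Reals.
From Coquelicot Require Import Coquelicot.
Local Open Scope R_scope.

Definition unit_disc (z : C) : Prop := Cmod z < 1.

(* Functions on the disc are total functions [C -> C]; only their values on
   the disc matter, since the disc is open. Analyticity is complex
   differentiability at every point of the disc. The normed module is given
   explicitly because [C] also carries a real normed module structure. *)
Definition analytic_in_disc (f : C -> C) : Prop :=
  forall z : C, unit_disc z -> @ex_derive C_AbsRing C_NormedModule f z.

Definition disc_sup (g : C -> R) : Rbar :=
  Lub_Rbar (fun x : R => exists z : C, unit_disc z /\ x = g z).

Definition bloch_seminorm (f : C -> C) : Rbar :=
  disc_sup (fun z : C => Cmod (C_derive f z) * (1 - Cmod z ^ 2)).

Definition in_bloch (f : C -> C) : Prop :=
  analytic_in_disc f /\ Rbar_lt (bloch_seminorm f) p_infty.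

(* [C_derive] is total, so the existence of both derivatives is required
   explicitly. *)
Definition is_solution (A f : C -> C) : Prop :=
  analytic_in_disc f /\
  analytic_in_disc (C_derive f) /\
  forall z : C, unit_disc z ->
    Cplus (C_derive (C_derive f) z) (Cmult (A z) (f z)) = RtoC 0.

Definition linearly_independent (f1 f2 : C -> C) : Prop :=
  forall a b : C,
    (forall z : C, unit_disc z ->
       Cplus (Cmult a (f1 z)) (Cmult b (f2 z)) = RtoC 0) ->
    a = RtoC 0 /\ b = RtoC 0.

Definition wronskian (f1 f2 : C -> C) (z : C) : C :=
  Cminus (Cmult (f1 z) (C_derive f2 z)) (Cmult (C_derive f1 z) (f2 z)).

Definition Rbar_max (x y : Rbar) : Rbar := if Rbar_le_dec x y then y else x.

(* Main.v *)
Require Import Defs.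
From Stdlib Require Import Reals Lra Psatz ClassicalEpsilon.
From Coquelicot Require Import Coquelicot.
From mathcomp Require Import ssreflect.
Local Open Scope R_scope.

(** Write h_j = f_j', u = |f1|^2 + |f2|^2, v = |h1|^2 + |h2|^2, and let M bound
    both Bloch seminorms. The proof is a maximum principle of Ahlfors-Bernstein
    type; it uses neither Cauchy's integral formula nor a bound on f_j''.

    Fix z0 and put r = (1 - |z0|)/2, so that |h_j| <= M/r on the disc
    D(z0, r). Let q = r^2 - |z - z0|^2 and k = |c| r, and consider

      |A|^2 (k + u) q^4 exp(r^2 v / M^2)

    on D(z0, r). It vanishes on the boundary circle, so if A(z0) is not 0 it has an
    interior maximum with positive value, and there the Laplacian of its logarithm is at most 0. Each factor
    contributes explicitly:
    - log |A|^2 is harmonic;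
    - the Laplacian of log (k + u) is 4 (k v + |c|^2)/(k + u)^2, where the
      Wronskian c comes from the Lagrange identity for the vectors (f1, f2) and
      (h1, h2);
    - log q^4 contributes -16 r^2/q^2;
    - the Laplacian of v is 4 (|f1''|^2 + |f2''|^2) = 4 |A|^2 u by the equation.
    Since u v >= |c|^2, at the maximum both |A|^2 u q^2 <= 4 M^2 and
    |c|^2 q^2 <= 4 r^2 u (k + u) hold, and these give
    |A|^2 (k + u) q^4 <= 64 r^4 M^2 there ([critical_point_bound]). As the
    exponential lies between 1 and e^2 < 9, comparing with the value at the
    centre gives |A(z0)|^2 |c| r^5 <= C M^2, which is the theorem with K a
    multiple of |c|^(-1/2).

    The coefficient A is only known to be once complex differentiable, whereas
    the second derivative test needs two derivatives of every factor. So A is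
    replaced by (h1(z) h2(z+t) - h2(z) h1(z+t))/(c t) with t > 0 small. By the
    Wronskian identity c A = h1 h2' - h2 h1' this tends to A uniformly near z0
    as t tends to 0, and it is twice differentiable because h_j' = - A f_j
    inherits a derivative from A. The true A still appears in the Laplacian of
    v, so the estimate at the maximum is untouched ([weighted_le_at_maximum],
    [solution_pair_bound]). *)

(** * Second derivatives of real functions of one variable *)

(** The first derivative is required on a neighbourhood, the second only at the
    point: this is what the second derivative test needs, and all that is
    available for [C_derive f] when f'' = - A f with A once differentiable. *)
Definition jet2 (phi : R -> R) (t d1 d2 : R) : Prop :=
  exists dphi : R -> R,
    locally t (fun s => is_derive phi s (dphi s)) /\
    dphi t = d1 /\ is_derive dphi t d2.

Lemma jet2_plus (phi psi : R -> R) (t d1 d2 e1 e2 : R) :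
  jet2 phi t d1 d2 -> jet2 psi t e1 e2 ->
  jet2 (fun s => phi s + psi s) t (d1 + e1) (d2 + e2).
Proof.
  intros (dphi & Hphi & <- & Hd) (dpsi & Hpsi & <- & He).
  exists (fun s => dphi s + dpsi s); split; [|split; [by []|]].
  - apply: filter_imp (filter_and _ _ Hphi Hpsi) => s [H1 H2].
    exact (is_derive_plus phi psi s _ _ H1 H2).
  - exact (is_derive_plus dphi dpsi t _ _ Hd He).
Qed.

Lemma jet2_scal (k : R) (phi : R -> R) (t d1 d2 : R) :
  jet2 phi t d1 d2 -> jet2 (fun s => k * phi s) t (k * d1) (k * d2).
Proof.
  intros (dphi & Hphi & <- & Hd).
  exists (fun s => k * dphi s); split; [|split; [by []|]].
  - apply: filter_imp Hphi => s H1. exact (is_derive_scal phi s k _ H1).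
  - exact (is_derive_scal dphi t k _ Hd).
Qed.

Lemma jet2_const (k t : R) : jet2 (fun _ => k) t 0 0.
Proof.
  exists (fun _ => 0); split; [|split; [by []|]].
  - apply: filter_forall => s. exact (is_derive_const k s).
  - exact (is_derive_const 0 t).
Qed.

Lemma jet2_square (phi : R -> R) (t d1 d2 : R) :
  jet2 phi t d1 d2 ->
  jet2 (fun s => phi s ^ 2) t (2 * phi t * d1) (2 * (d1 ^ 2 + phi t * d2)).
Proof.
  intros (dphi & Hphi & <- & Hd).
  exists (fun s => 2 * phi s * dphi s); split; [|split; [by []|]].
  - apply: filter_imp Hphi => s H1.
    auto_derive; [by exists (dphi s)|].
    rewrite (is_derive_unique _ _ _ H1); ring.
  - have H1 := locally_singleton _ _ Hphi.
    auto_derive; [by split; [exists (dphi t)|split; [exists d2|]]|].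
    rewrite (is_derive_unique _ _ _ H1) (is_derive_unique _ _ _ Hd); ring.
Qed.

Lemma jet2_ln (phi : R -> R) (t d1 d2 : R) :
  0 < phi t -> jet2 phi t d1 d2 ->
  jet2 (fun s => ln (phi s)) t (d1 / phi t) (d2 / phi t - (d1 / phi t) ^ 2).
Proof.
  intros Hpos (dphi & Hphi & <- & Hd).
  have H0 := locally_singleton _ _ Hphi.
  exists (fun s => dphi s / phi s); split; [|split; [by []|]].
  - have Hc : continuous phi t by apply: ex_derive_continuous; exists (dphi t).
    have Hp : locally t (fun s => 0 < phi s).
    { apply: (Hc (fun y => 0 < y)). exact: open_gt. }
    apply: filter_imp (filter_and _ _ Hphi Hp) => s [H1 H2].
    auto_derive; [by split; [exists (dphi s)|]|].
    rewrite (is_derive_unique _ _ _ H1). field. lra.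
  - auto_derive; [split; [by exists d2|split; [by exists (dphi t)|split; [lra|by []]]]|].
    rewrite (is_derive_unique _ _ _ H0) (is_derive_unique _ _ _ Hd). field. lra.
Qed.

Lemma jet2_ext (phi psi : R -> R) (t d1 d2 : R) :
  (forall s, phi s = psi s) -> jet2 phi t d1 d2 -> jet2 psi t d1 d2.
Proof.
  intros E (dphi & Hphi & <- & Hd).
  exists dphi; split; [|split => //].
  apply: filter_imp Hphi => s. exact: is_derive_ext.
Qed.

(** If [d2 > 0] then, the first derivative being zero at [t], it is positive just
    to the right of [t], and the mean value theorem contradicts maximality. *)
Lemma jet2_local_max (phi : R -> R) (t d1 d2 : R) :
  locally t (fun s => phi s <= phi t) -> jet2 phi t d1 d2 -> d2 <= 0.
Proof.
  intros Hmax (dphi & Hphi & _ & Hd).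
  apply: Rnot_lt_le => Hpos.
  have H0 := locally_singleton _ _ Hphi.
  have Hcrit : dphi t = 0.
  { case: Hmax => e He.
    have pr : derivable_pt phi t by exists (dphi t); apply/is_derive_Reals.
    rewrite -(is_derive_unique _ _ _ H0) -(Derive_Reals _ _ pr).
    apply: (deriv_maximum phi (t - e) (t + e)).
    - case: e {He} => e /=; lra.
    - case: e {He} => e /=; lra.
    - move=> x H1 H2; apply: He; rewrite /ball /= /AbsRing_ball /abs /minus /plus /opp /=.
      apply: Rabs_def1; lra. }
  (* just to the right of [t] the derivative is positive *)
  have [e He] : locally t (fun s => Rabs (dphi s - d2 * (s - t)) <= d2 / 2 * Rabs (s - t)).
  { have := proj2 Hd t (fun P H => H). rewrite /is_domin => H.
    have H2 : 0 < d2 / 2 by lra.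
    move: (H (mkposreal _ H2)) => {}H.
    apply: filter_imp H => s /=.
    rewrite /norm /= /abs /minus /plus /opp /scal /= /mult /= Hcrit => H.
    replace (dphi s - d2 * (s - t)) with (dphi s + - 0 + - ((s + - t) * d2)) by ring.
    exact: H. }
  case: (filter_and _ _ Hphi Hmax) => e' He'.
  pose m := Rmin e e' / 2.
  have [Hm1 Hm2] : 0 < m < Rmin e e'.
  { have : 0 < Rmin e e' by apply: Rmin_pos; apply: cond_pos.
    rewrite /m; lra. }
  have Hme : m < e by apply: Rlt_le_trans Hm2 (Rmin_l _ _).
  have Hme' : m < e' by apply: Rlt_le_trans Hm2 (Rmin_r _ _).
  have Hball : forall (r : posreal) s, t <= s <= t + m -> m < r -> ball t r s.
  { move=> r s Hs Hr; rewrite /ball /= /AbsRing_ball /abs /minus /plus /opp /=.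
    apply: Rabs_def1; lra. }
  have [s [Hs Es]] := MVT_cor2 phi dphi t (t + m) ltac:(lra)
     (fun s Hs => proj1 (is_derive_Reals _ _ _) (proj1 (He' s (Hball _ _ Hs Hme')))).
  have Hle := proj2 (He' (t + m) (Hball e' (t + m) ltac:(lra) Hme')).
  have := He s (Hball e s ltac:(lra) Hme).
  rewrite (Rabs_right (s - t)); [|lra].
  move/Rabs_le_between => [H1 _].
  have : 0 < dphi s by nra.
  nra.
Qed.

(** * Cauchy-Riemann equations and Laplacians of squared moduli *)

(** Complex differentiability seen only along the horizontal and the vertical line
    through [z]. Existence of the partial derivatives together with the
    Cauchy-Riemann equations is enough for computing Laplacians, and it is stable
    under ring operations by the one-variable rules. *)
Definition cauchy_riemann (f : C -> C) (z l : C) : Prop :=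
  (is_derive (fun t => Re (f (t, Im z))) (Re z) (Re l) /\
   is_derive (fun t => Im (f (t, Im z))) (Re z) (Im l)) /\
  (is_derive (fun t => Re (f (Re z, t))) (Im z) (- Im l) /\
   is_derive (fun t => Im (f (Re z, t))) (Im z) (Re l)).

Lemma is_derive_cauchy_riemann (f : C -> C) (z l : C) :
  @is_derive C_AbsRing C_NormedModule f z l -> cauchy_riemann f z l.
Proof.
  case: z => x y H.
  have Hd : forall e : posreal, exists d : posreal, forall w : C,
      Cmod (w - (x, y))%C < d ->
      Cmod (f w - f (x, y) - (w - (x, y)) * l)%C <= e * Cmod (w - (x, y))%C.
  { move=> e. exact (proj2 H (x, y) (fun P HP => HP) e). }
  have key : forall (p : C -> R) (u : C) (s : R),
      (forall w, Rabs (p w) <= Cmod w) ->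
      (forall a b, p (a - b)%C = p a - p b) ->
      (forall t : R, p (RtoC t * u * l)%C = t * s) -> Cmod u = 1 ->
      is_derive (fun t : R => p (f ((x, y) + RtoC t * u)%C)) 0 s.
  { move=> p u s Hp Hsub Hs Hu; split; [exact: is_linear_scal_l|].
    move=> t Ht e; have -> : t = 0.
    { symmetry; apply: (is_filter_lim_locally_unique (K := R_AbsRing) (V := R_NormedModule)). exact: Ht. }
    case: (Hd e) => d Hd'.
    exists d => t' Ht'.
    have Et : ((x, y) + RtoC t' * u - (x, y) = RtoC t' * u)%C by ring.
    have Hb : Cmod ((x, y) + RtoC t' * u - (x, y))%C < d.
    { rewrite Et Cmod_mult Hu Cmod_R Rmult_1_r.
      move: Ht'; rewrite /ball /= /AbsRing_ball /abs /minus /plus /opp /=.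
      by rewrite Ropp_0 Rplus_0_r. }
    move: (Hd' _ Hb). rewrite Et Cmod_mult Hu Cmod_R Rmult_1_r => H1.
    rewrite /norm /= /abs /minus /plus /opp /scal /= /mult /=.
    have -> : ((x, y) + RtoC 0 * u)%C = (x, y).
    { change ((x, y) + RtoC 0 * u = (x, y))%C; ring. }
    rewrite Ropp_0 Rplus_0_r -Hs -!/(Rminus _ _) -!Hsub.
    exact: Rle_trans (Hp _) H1. }
  have HRe : forall w, Rabs (Re w) <= Cmod w.
  { move=> w. exact: Rle_trans (Rmax_l _ _) (Rmax_Cmod w). }
  have HIm : forall w, Rabs (Im w) <= Cmod w.
  { move=> w. exact: Rle_trans (Rmax_r _ _) (Rmax_Cmod w). }
  have shift : forall (phi psi : R -> R) (a s : R), (forall t, phi (t - a) = psi t) ->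
     is_derive phi 0 s -> is_derive psi a s.
  { move=> phi psi a s E H1. apply: (is_derive_ext (fun t => phi (t - a))) => //.
    have {}H1 : is_derive phi (a - a) s by rewrite Rminus_diag_eq.
    auto_derive; [by exists s|].
    rewrite (is_derive_unique _ _ _ H1); ring. }
  split; split => /=.
  - apply: shift (key Re (RtoC 1) (Re l) HRe _ _ _) => //=.
    + move=> t; congr (Re (f _)); rewrite /Cplus /Cmult /RtoC /=; congr pair; ring.
    + move=> t; rewrite /Re /Im /=; ring.
    + exact: Cmod_1.
  - apply: shift (key Im (RtoC 1) (Im l) HIm _ _ _) => //=.
    + move=> t; congr (Im (f _)); rewrite /Cplus /Cmult /RtoC /=; congr pair; ring.
    + move=> t; rewrite /Re /Im /=; ring.
    + exact: Cmod_1.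
  - apply: shift (key Re Ci (- Im l) HRe _ _ _) => //=.
    + move=> t; congr (Re (f _)); rewrite /Cplus /Cmult /RtoC /=; congr pair; ring.
    + move=> t; rewrite /Re /Im /=; ring.
    + by rewrite /Cmod /=; rewrite Rmult_0_l Rplus_0_l !Rmult_1_r sqrt_1.
  - apply: shift (key Im Ci (Re l) HIm _ _ _) => //=.
    + move=> t; congr (Im (f _)); rewrite /Cplus /Cmult /RtoC /=; congr pair; ring.
    + move=> t; rewrite /Re /Im /=; ring.
    + by rewrite /Cmod /=; rewrite Rmult_0_l Rplus_0_l !Rmult_1_r sqrt_1.
Qed.

Lemma is_derive_eq (f : R -> R) (t l m : R) :
  is_derive f t l -> l = m -> is_derive f t m.
Proof. by move=> H <-. Qed.

Lemma cauchy_riemann_opp (f : C -> C) (z l : C) :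
  cauchy_riemann f z l -> cauchy_riemann (fun w => - f w)%C z (- l)%C.
Proof.
  move=> [[f1 f2] [f3 f4]]; split; split.
  - exact (is_derive_opp _ _ _ f1).
  - exact (is_derive_opp _ _ _ f2).
  - exact (is_derive_opp _ _ _ f3).
  - exact (is_derive_opp _ _ _ f4).
Qed.

Lemma cauchy_riemann_minus (f g : C -> C) (z l m : C) :
  cauchy_riemann f z l -> cauchy_riemann g z m ->
  cauchy_riemann (fun w => f w - g w)%C z (l - m)%C.
Proof.
  move=> [[f1 f2] [f3 f4]] [[g1 g2] [g3 g4]]; split; split.
  - exact: is_derive_eq (is_derive_minus _ _ _ _ _ f1 g1) _.
  - exact: is_derive_eq (is_derive_minus _ _ _ _ _ f2 g2) _.
  - apply: is_derive_eq (is_derive_minus _ _ _ _ _ f3 g3) _.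
    rewrite /minus /plus /opp /Re /Im /=; ring.
  - exact: is_derive_eq (is_derive_minus _ _ _ _ _ f4 g4) _.
Qed.

Lemma cauchy_riemann_plus (f g : C -> C) (z l m : C) :
  cauchy_riemann f z l -> cauchy_riemann g z m ->
  cauchy_riemann (fun w => f w + g w)%C z (l + m)%C.
Proof.
  move=> [[f1 f2] [f3 f4]] [[g1 g2] [g3 g4]]; split; split.
  - exact: is_derive_eq (is_derive_plus _ _ _ _ _ f1 g1) _.
  - exact: is_derive_eq (is_derive_plus _ _ _ _ _ f2 g2) _.
  - apply: is_derive_eq (is_derive_plus _ _ _ _ _ f3 g3) _.
    rewrite /plus /Re /Im /=; ring.
  - exact: is_derive_eq (is_derive_plus _ _ _ _ _ f4 g4) _.
Qed.

Lemma is_derive_products (k : R) (a b c d : R -> R) (t a' b' c' d' : R) :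
  is_derive a t a' -> is_derive b t b' -> is_derive c t c' -> is_derive d t d' ->
  is_derive (fun s => a s * b s + k * (c s * d s)) t
    (a' * b t + a t * b' + k * (c' * d t + c t * d')).
Proof.
  move=> Ha Hb Hc Hd.
  auto_derive.
  - by repeat (split; [eexists; eassumption|]).
  - rewrite (is_derive_unique _ _ _ Ha) (is_derive_unique _ _ _ Hb)
      (is_derive_unique _ _ _ Hc) (is_derive_unique _ _ _ Hd); ring.
Qed.

Lemma cauchy_riemann_mult (f g : C -> C) (z l m : C) :
  cauchy_riemann f z l -> cauchy_riemann g z m ->
  cauchy_riemann (fun w => f w * g w)%C z (l * g z + f z * m)%C.
Proof.
  case: z => x y [[/= f1 f2] [f3 f4]] [[/= g1 g2] [g3 g4]]; split; split => /=.
  all: [> have H := is_derive_products (-1) _ _ _ _ _ _ _ _ _ f1 g1 f2 g2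
        | have H := is_derive_products 1 _ _ _ _ _ _ _ _ _ f1 g2 f2 g1
        | have H := is_derive_products (-1) _ _ _ _ _ _ _ _ _ f3 g3 f4 g4
        | have H := is_derive_products 1 _ _ _ _ _ _ _ _ _ f3 g4 f4 g3 ].
  all: apply: is_derive_eq; [apply: is_derive_ext H => t|];
    rewrite /Re /Im /=; ring.
Qed.

Lemma cauchy_riemann_const (k z : C) : cauchy_riemann (fun _ => k) z (RtoC 0).
Proof.
  split; split; apply: is_derive_eq (is_derive_const _ _) _ => //=.
  by rewrite Ropp_0.
Qed.

Lemma cauchy_riemann_shift (f : C -> C) (h : R) (z l : C) :
  cauchy_riemann f (z + RtoC h)%C l ->
  cauchy_riemann (fun w => f (w + RtoC h))%C z l.
Proof.
  case: z => x y [[/= f1 f2] [f3 f4]].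
  have E : forall s t, ((s, t) + RtoC h)%C = (s + h, t).
  { move=> s t; rewrite /Cplus /RtoC /=; congr pair; ring. }
  have D : forall (phi : R -> R) d, is_derive phi (x + h) d -> is_derive (fun t => phi (t + h)) x d.
  { move=> phi d H; auto_derive; [by exists d|].
    rewrite (is_derive_unique _ _ _ H); ring. }
  move: f1 f2 f3 f4; rewrite Rplus_0_r => f1 f2 f3 f4.
  split; split => /=.
  - apply: is_derive_ext (D _ _ f1) => t. by rewrite E.
  - apply: is_derive_ext (D _ _ f2) => t. by rewrite E.
  - apply: is_derive_ext f3 => t. by rewrite E.
  - apply: is_derive_ext f4 => t. by rewrite E.
Qed.

Lemma locally_horizontal (P : C -> Prop) (x y : R) :
  locally ((x, y) : C) P -> locally x (fun t => P (t, y)).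
Proof.
  move=> [e He]; exists e => t Ht; apply: He; split => //. exact: ball_center.
Qed.

Lemma locally_vertical (P : C -> Prop) (x y : R) :
  locally ((x, y) : C) P -> locally y (fun t => P (x, t)).
Proof.
  move=> [e He]; exists e => t Ht; apply: He; split => //. exact: ball_center.
Qed.

(** Two complex derivatives, the second at [z] only; compare [jet2]. *)
Definition holomorphic2 (f : C -> C) (z l m : C) : Prop :=
  exists df : C -> C,
    locally z (fun w => cauchy_riemann f w (df w)) /\
    df z = l /\ cauchy_riemann df z m.

(** Along a vertical line each complex derivative brings a factor i, hence the sign
    change of the second derivatives that makes the parts of [f] harmonic. *)
Lemma holomorphic2_jets (f : C -> C) (x y : R) (l m : C) :
  holomorphic2 f (x, y) l m ->
  (jet2 (fun t => Re (f (t, y))) x (Re l) (Re m) /\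
    jet2 (fun t => Im (f (t, y))) x (Im l) (Im m)) /\
  (jet2 (fun t => Re (f (x, t))) y (- Im l) (- Re m) /\
    jet2 (fun t => Im (f (x, t))) y (Re l) (- Im m)).
Proof.
  move=> [df [Hf [<- [[/= d1 d2] [d3 d4]]]]].
  have Hh := locally_horizontal _ _ _ Hf.
  have Hv := locally_vertical _ _ _ Hf.
  split; split.
  - exists (fun t => Re (df (t, y))); split; [|by []].
    by apply: filter_imp Hh => s [[H _] _].
  - exists (fun t => Im (df (t, y))); split; [|by []].
    by apply: filter_imp Hh => s [[_ H] _].
  - exists (fun t => - Im (df (x, t))); split; [|split; [by []|]].
    + by apply: filter_imp Hv => s [_ [H _]].
    + exact (is_derive_opp _ _ _ d4).
  - exists (fun t => Re (df (x, t))); split; [|by []].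
    by apply: filter_imp Hv => s [_ [_ H]].
Qed.

Lemma holomorphic2_minus (f g : C -> C) (z l m l' m' : C) :
  holomorphic2 f z l m -> holomorphic2 g z l' m' ->
  holomorphic2 (fun w => f w - g w)%C z (l - l')%C (m - m')%C.
Proof.
  move=> [df [Hf [<- Hdf]]] [dg [Hg [<- Hdg]]].
  exists (fun w => df w - dg w)%C; split; [|split; [by []|exact: cauchy_riemann_minus]].
  apply: filter_imp (filter_and _ _ Hf Hg) => w [H1 H2].
  exact: cauchy_riemann_minus.
Qed.

Lemma holomorphic2_mult (f g : C -> C) (z l m l' m' : C) :
  holomorphic2 f z l m -> holomorphic2 g z l' m' ->
  holomorphic2 (fun w => f w * g w)%C z (l * g z + f z * l')%C
    (m * g z + l * l' + (l * l' + f z * m'))%C.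
Proof.
  move=> [df [Hf [<- Hdf]]] [dg [Hg [<- Hdg]]].
  exists (fun w => df w * g w + f w * dg w)%C; split; [|split; [by []|]].
  - apply: filter_imp (filter_and _ _ Hf Hg) => w [H1 H2].
    exact: cauchy_riemann_mult.
  - have Hf0 := locally_singleton _ _ Hf.
    have Hg0 := locally_singleton _ _ Hg.
    apply: cauchy_riemann_plus; exact: cauchy_riemann_mult.
Qed.

Definition has_laplacian (phi : C -> R) (z : C) (L : R) : Prop :=
  exists dx dxx dy dyy : R,
    jet2 (fun t => phi (t, Im z)) (Re z) dx dxx /\
    jet2 (fun t => phi (Re z, t)) (Im z) dy dyy /\ dxx + dyy = L.

Lemma has_laplacian_plus (phi psi : C -> R) (z : C) (L M : R) :
  has_laplacian phi z L -> has_laplacian psi z M ->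
  has_laplacian (fun w => phi w + psi w) z (L + M).
Proof.
  move=> [dx [dxx [dy [dyy [H1 [H2 <-]]]]]] [ex [exx [ey [eyy [K1 [K2 <-]]]]]].
  exists (dx + ex), (dxx + exx), (dy + ey), (dyy + eyy); split; [|split].
  - exact: jet2_plus.
  - exact: jet2_plus.
  - ring.
Qed.

Lemma has_laplacian_scal (k : R) (phi : C -> R) (z : C) (L : R) :
  has_laplacian phi z L -> has_laplacian (fun w => k * phi w) z (k * L).
Proof.
  move=> [dx [dxx [dy [dyy [H1 [H2 <-]]]]]].
  exists (k * dx), (k * dxx), (k * dy), (k * dyy); split; [|split].
  - exact: jet2_scal.
  - exact: jet2_scal.
  - ring.
Qed.

Lemma has_laplacian_local_max (phi : C -> R) (z : C) (L : R) :
  locally z (fun w => phi w <= phi z) -> has_laplacian phi z L -> L <= 0.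
Proof.
  case: z => x y Hmax [dx [dxx [dy [dyy [/= H1 [H2 <-]]]]]].
  have := jet2_local_max _ _ _ _ (locally_horizontal _ _ _ Hmax) H1.
  have := jet2_local_max _ _ _ _ (locally_vertical _ _ _ Hmax) H2.
  lra.
Qed.

Definition sqmod (z : C) : R := Re z ^ 2 + Im z ^ 2.

(** The terms with second derivatives of [f] and [g] change sign between the two
    directions, so only the squared first derivatives survive in the sum. The
    first-order terms are recorded because taking a logarithm brings in the
    gradient. *)
Lemma jets_sum_squares (k : R) (f g : C -> C) (x y : R) (f1 f2 g1 g2 : C) :
  holomorphic2 f (x, y) f1 f2 -> holomorphic2 g (x, y) g1 g2 ->
  let F := f (x, y) in let G := g (x, y) in
  exists dxx dyy,
  jet2 (fun t => k + (sqmod (f (t, y)) + sqmod (g (t, y)))) x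
    (2 * (Re F * Re f1 + Im F * Im f1 + Re G * Re g1 + Im G * Im g1)) dxx /\
  jet2 (fun t => k + (sqmod (f (x, t)) + sqmod (g (x, t)))) y
    (2 * (Im F * Re f1 - Re F * Im f1 + Im G * Re g1 - Re G * Im g1)) dyy /\
  dxx + dyy = 4 * (sqmod f1 + sqmod g1).
Proof.
  move=> Hf Hg F G.
  have [[fa fb] [fc fd]] := holomorphic2_jets _ _ _ _ _ Hf.
  have [[ga gb] [gc gd]] := holomorphic2_jets _ _ _ _ _ Hg.
  have Hx := jet2_plus _ _ _ _ _ _ _ (jet2_const k x)
    (jet2_plus _ _ _ _ _ _ _
      (jet2_plus _ _ _ _ _ _ _ (jet2_square _ _ _ _ fa) (jet2_square _ _ _ _ fb))
      (jet2_plus _ _ _ _ _ _ _ (jet2_square _ _ _ _ ga) (jet2_square _ _ _ _ gb))).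
  have Hy := jet2_plus _ _ _ _ _ _ _ (jet2_const k y)
    (jet2_plus _ _ _ _ _ _ _
      (jet2_plus _ _ _ _ _ _ _ (jet2_square _ _ _ _ fc) (jet2_square _ _ _ _ fd))
      (jet2_plus _ _ _ _ _ _ _ (jet2_square _ _ _ _ gc) (jet2_square _ _ _ _ gd))).
  eexists; eexists; split; [|split].
  - match type of Hx with jet2 _ _ ?d _ =>
      replace (2 * (Re F * Re f1 + Im F * Im f1 + Re G * Re g1 + Im G * Im g1)) with d
        by (rewrite /F /G; ring) end.
    exact: Hx.
  - match type of Hy with jet2 _ _ ?d _ =>
      replace (2 * (Im F * Re f1 - Re F * Im f1 + Im G * Re g1 - Re G * Im g1)) with d
        by (rewrite /F /G; ring) end.
    exact: Hy.
  - rewrite /sqmod; ring.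
Qed.

Lemma has_laplacian_sum_squares (f g : C -> C) (z f1 f2 g1 g2 : C) :
  holomorphic2 f z f1 f2 -> holomorphic2 g z g1 g2 ->
  has_laplacian (fun w => sqmod (f w) + sqmod (g w)) z (4 * (sqmod f1 + sqmod g1)).
Proof.
  case: z => x y Hf Hg.
  have [dxx [dyy [H1 [H2 E]]]] := jets_sum_squares 0 _ _ _ _ _ _ _ _ Hf Hg.
  eexists; exists dxx; eexists; exists dyy; split; [|split; [|exact: E]].
  - apply: jet2_ext H1 => s; exact: Rplus_0_l.
  - apply: jet2_ext H2 => s; exact: Rplus_0_l.
Qed.

(** The Lagrange identity turns (|f|^2 + |g|^2)(|f'|^2 + |g'|^2) minus the squared
    gradient term into the squared modulus of the Wronskian. With [k = 0] and
    [g = 0] the numerator vanishes, which is the harmonicity of log |f|^2. *)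
Lemma has_laplacian_ln_sum_squares (k : R) (f g : C -> C) (z f1 f2 g1 g2 : C) :
  holomorphic2 f z f1 f2 -> holomorphic2 g z g1 g2 ->
  0 < k + (sqmod (f z) + sqmod (g z)) ->
  has_laplacian (fun w => ln (k + (sqmod (f w) + sqmod (g w)))) z
    (4 * (k * (sqmod f1 + sqmod g1) + sqmod (f z * g1 - f1 * g z)%C)
       / (k + (sqmod (f z) + sqmod (g z))) ^ 2).
Proof.
  case: z => x y Hf Hg Hpos.
  have [dxx [dyy [H1 [H2 E]]]] := jets_sum_squares k _ _ _ _ _ _ _ _ Hf Hg.
  eexists; eexists; eexists; eexists; split; [|split].
  - exact: jet2_ln Hpos H1.
  - exact: jet2_ln Hpos H2.
  - have -> : dyy = 4 * (sqmod f1 + sqmod g1) - dxx by lra.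
    move: Hpos => /=. move: (f (x, y)) (g (x, y)) => [a b] [c d].
    case: f1 {Hf H1 H2 E} => a' b'. case: g1 {Hg} => c' d'.
    rewrite /sqmod /Re /Im /= => Hpos. field. lra.
Qed.

(** * Continuous functions on a closed square *)

Definition in_square (z0 : C) (r : R) (z : C) : Prop :=
  Rabs (Re z - Re z0) <= r /\ Rabs (Im z - Im z0) <= r.

Lemma square_uniformly_continuous (phi : C -> R) (z0 : C) (r e : R) :
  (forall z, in_square z0 r z -> continuous phi z) -> 0 < e ->
  exists d : R, 0 < d /\ forall z w, in_square z0 r z -> in_square z0 r w ->
    Rabs (Re w - Re z) < d -> Rabs (Im w - Im z) < d ->
    Rabs (phi w - phi z) < e.
Proof.
  case: z0 => x0 y0 Hc He.
  have Hc' : forall x y, x0 - r <= x <= x0 + r -> y0 - r <= y <= y0 + r ->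
      continuity_2d_pt (fun x y => phi (x, y)) x y.
  { move=> x y Hx Hy; apply/continuity_2d_pt_filterlim.
    have H : continuous phi (x, y).
    { apply: Hc; split; apply: Rabs_le => /=; lra. }
    apply: (filterlim_ext phi) => //; by case. }
  have [d Hd] := uniform_continuity_2d _ _ _ _ _ Hc' (mkposreal e He).
  exists d; split; [exact: cond_pos|].
  move=> [x y] [u v] [/= /Rabs_le_between Hx /Rabs_le_between Hy]
    [/= /Rabs_le_between Hu /Rabs_le_between Hv] H1 H2.
  apply: (Hd x y u v) => //; lra.
Qed.

(** The extreme value theorem in two variables, from the one-variable theorem used
    twice: the maximum over a vertical segment depends continuously on the
    abscissa by uniform continuity. The larger half-side [s] leaves room for
    two-sided continuity at the edges of the square of half-side [r]. *)
Lemma square_maximum (phi : C -> R) (z0 : C) (r s : R) :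
  0 < r < s -> (forall z, in_square z0 s z -> continuous phi z) ->
  exists p, in_square z0 r p /\ forall z, in_square z0 r z -> phi z <= phi p.
Proof.
  case: z0 => x0 y0 Hrs Hc.
  have inS : forall t x y, x0 - t <= x <= x0 + t -> y0 - t <= y <= y0 + t ->
      in_square (x0, y0) t (x, y).
  { move=> t x y Hx Hy; split; apply: Rabs_le => /=; lra. }
  (* the maximum over each vertical segment, attained at ordinate [h x] *)
  have [h Hh] : exists h : R -> R, forall x, x0 - s <= x <= x0 + s ->
      (forall y, y0 - r <= y <= y0 + r -> phi (x, y) <= phi (x, h x)) /\
      y0 - r <= h x <= y0 + r.
  { have E : forall x, exists y', x0 - s <= x <= x0 + s ->
      (forall y, y0 - r <= y <= y0 + r -> phi (x, y) <= phi (x, y')) /\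
      y0 - r <= y' <= y0 + r.
    { move=> x. case: (excluded_middle_informative (x0 - s <= x <= x0 + s)) => Hx; last first.
      { by exists 0. }
      have [|y Hy|y Hy] := continuity_ab_maj (fun y => phi (x, y)) (y0 - r) (y0 + r).
      - lra.
      - apply/continuity_pt_filterlim.
        have Hxy : continuous phi (x, y) by apply: Hc; apply: inS; lra.
        move=> P HP. exact: (locally_vertical (fun w => P (phi w)) x y (Hxy P HP)).
      - by exists y. }
    exists (fun x => proj1_sig (constructive_indefinite_description _ (E x))) => x.
    exact: (proj2_sig (constructive_indefinite_description _ (E x))). }
  have [|x Hx|x [Hmax Hx]] := continuity_ab_maj (fun x => phi (x, h x)) (x0 - r) (x0 + r).
  - lra.
  - apply/continuity_pt_locally => e.
    have [d [Hd H]] := square_uniformly_continuous phi (x0, y0) s e Hc (cond_pos e).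
    have Hd' : 0 < Rmin d (s - r) by apply: Rmin_pos; lra.
    suff near : forall u : R, Rabs (u - x) < Rmin d (s - r) ->
        Rabs (phi (u, h u) - phi (x, h x)) < e.
    { by exists (mkposreal _ Hd') => u; apply: near. }
    move=> u Hu.
    have Hu1 : Rabs (u - x) < d by apply: Rlt_le_trans Hu (Rmin_l _ _).
    have Hu2 : Rabs (u - x) < s - r by apply: Rlt_le_trans Hu (Rmin_r _ _).
    move/Rabs_def2: Hu2 => Hu2.
    have [|M1 B1] := Hh x; [lra|]. have [|M2 B2] := Hh u; [lra|].
    have close : forall y, y0 - r <= y <= y0 + r -> Rabs (phi (u, y) - phi (x, y)) < e.
    { move=> y Hy; apply: H => /=; [apply: inS; lra|apply: inS; lra|by []|].
      by rewrite Rminus_diag Rabs_R0. }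
    have [C1 C2] := Rabs_def2 _ _ (close (h x) B1).
    have [C3 C4] := Rabs_def2 _ _ (close (h u) B2).
    have C5 := M1 (h u) B2. have C6 := M2 (h x) B1.
    apply: Rabs_def1; lra.
  - have [|M1 B1] := Hh x; [lra|].
    exists (x, h x); split; [apply: inS; lra|].
    move=> [u v] [/= /Rabs_le_between Hu /Rabs_le_between Hv].
    apply: (Rle_trans _ (phi (u, h u))).
    + apply: (proj1 (Hh u _)); lra.
    + apply: Hmax; lra.
Qed.

(** * Complex differentiable functions on the unit disc *)

Definition derivative_in_disc (f df : C -> C) : Prop :=
  forall z, unit_disc z -> @is_derive C_AbsRing C_NormedModule f z (df z).

Lemma derivative_in_disc_cauchy_riemann (f df : C -> C) (z : C) :
  derivative_in_disc f df -> unit_disc z -> cauchy_riemann f z (df z).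
Proof. move=> H Hz. exact: is_derive_cauchy_riemann (H z Hz). Qed.

Lemma Cmod_le_sum (z : C) : Cmod z <= Rabs (Re z) + Rabs (Im z).
Proof.
  have H1 := Rabs_pos (Re z). have H2 := Rabs_pos (Im z).
  rewrite -(sqrt_Rsqr (Rabs (Re z) + Rabs (Im z))); [|lra].
  apply: sqrt_le_1_alt. rewrite -/(Re z) -/(Im z) -(pow2_abs (Re z)) -(pow2_abs (Im z)) /Rsqr.
  nra.
Qed.

Lemma locally_Cmod (z : C) (e : R) :
  0 < e -> locally z (fun w : C => Cmod (w - z)%C < e).
Proof.
  move=> He. have He2 : 0 < e / 2 by lra.
  exists (mkposreal _ He2) => w [H1 H2].
  apply: Rle_lt_trans (Cmod_le_sum _) _.
  have {}H1 : Rabs (Re (w - z)%C) < e / 2 by exact: H1.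
  have {}H2 : Rabs (Im (w - z)%C) < e / 2 by exact: H2.
  lra.
Qed.

Definition continuous_parts (f : C -> C) (z : C) : Prop :=
  continuous (fun w => Re (f w)) z /\ continuous (fun w => Im (f w)) z.

Lemma continuous_Rmult (p q : C -> R) (z : C) :
  continuous p z -> continuous q z -> continuous (fun w => p w * q w) z.
Proof. move=> Hp Hq. exact (continuous_mult p q z Hp Hq). Qed.

Lemma continuous_Rplus (p q : C -> R) (z : C) :
  continuous p z -> continuous q z -> continuous (fun w => p w + q w) z.
Proof. move=> Hp Hq. exact (continuous_plus (V := R_NormedModule) p q z Hp Hq). Qed.

Lemma continuous_Rminus (p q : C -> R) (z : C) :
  continuous p z -> continuous q z -> continuous (fun w => p w - q w) z.
Proof. move=> Hp Hq. exact (continuous_minus (V := R_NormedModule) p q z Hp Hq). Qed.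

Lemma continuous_parts_mult (f g : C -> C) (z : C) :
  continuous_parts f z -> continuous_parts g z ->
  continuous_parts (fun w => f w * g w)%C z.
Proof.
  move=> [f1 f2] [g1 g2]; split.
  - apply: continuous_Rminus; exact: continuous_Rmult.
  - apply: continuous_Rplus; exact: continuous_Rmult.
Qed.

Lemma continuous_parts_minus (f g : C -> C) (z : C) :
  continuous_parts f z -> continuous_parts g z ->
  continuous_parts (fun w => f w - g w)%C z.
Proof. move=> [f1 f2] [g1 g2]; split; exact: continuous_Rminus. Qed.

Lemma continuous_parts_opp (f : C -> C) (z : C) :
  continuous_parts f z -> continuous_parts (fun w => - f w)%C z.
Proof.
  move=> [f1 f2]; split; exact: (continuous_opp (V := R_NormedModule)).
Qed.

Lemma derivative_in_disc_continuous (f df : C -> C) (z : C) :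
  derivative_in_disc f df -> unit_disc z ->
  continuous_parts f z.
Proof.
  move=> H Hz.
  have Hc : @continuous C_UniformSpace C_UniformSpace f z.
  { have := ex_derive_continuous f z (ex_intro _ _ (H z Hz)).
    move=> Hc P HP. case: (Hc P HP) => e He.
    apply: filter_imp (locally_Cmod z e (cond_pos e)) => w Hw. exact: He. }
  have HR : continuous Re (f z) by case: (f z) => a b; exact: continuous_fst.
  have HI : continuous Im (f z) by case: (f z) => a b; exact: continuous_snd.
  split; [exact: continuous_comp Hc HR|exact: continuous_comp Hc HI].
Qed.

Lemma locally_unit_disc (z : C) : unit_disc z -> locally z unit_disc.
Proof.
  rewrite /unit_disc => Hz. have He : 0 < 1 - Cmod z by lra.
  apply: filter_imp (locally_Cmod z _ He) => w Hw.
  have := Cmod_triangle (w - z) z.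
  have -> : (w - z + z = w)%C by ring. lra.
Qed.

Lemma derivative_in_disc_holomorphic2 (f df : C -> C) (z l : C) :
  derivative_in_disc f df -> unit_disc z -> cauchy_riemann df z l ->
  holomorphic2 f z (df z) l.
Proof.
  move=> H Hz Hl; exists df; split; [|split => //].
  apply: filter_imp (locally_unit_disc z Hz) => w Hw.
  exact: derivative_in_disc_cauchy_riemann.
Qed.

Lemma locally_shift (P : C -> Prop) (h : R) (z : C) :
  locally (z + RtoC h)%C P -> locally z (fun w => P (w + RtoC h)%C).
Proof.
  move=> [e He]; exists e => w [H1 H2]; apply: He.
  have E : forall a b k : R, a + k + - (b + k) = a + - b by move=> *; ring.
  split; rewrite /= /ball /= /AbsRing_ball /abs /minus /plus /opp /= E; [exact: H1|exact: H2].
Qed.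

Lemma continuous_parts_shift (f : C -> C) (h : R) (z : C) :
  continuous_parts f (z + RtoC h)%C -> continuous_parts (fun w => f (w + RtoC h))%C z.
Proof.
  move=> [f1 f2]; split => P HP.
  - exact: (locally_shift (fun w => P (Re (f w))) _ _ (f1 P HP)).
  - exact: (locally_shift (fun w => P (Im (f w))) _ _ (f2 P HP)).
Qed.

Lemma holomorphic2_shift (f : C -> C) (h : R) (z l m : C) :
  holomorphic2 f (z + RtoC h)%C l m ->
  holomorphic2 (fun w => f (w + RtoC h))%C z l m.
Proof.
  move=> [df [Hf [E Hm]]].
  exists (fun w => df (w + RtoC h)%C); split; [|split; [by []|exact: cauchy_riemann_shift]].
  apply: filter_imp (locally_shift _ _ _ Hf) => w. exact: cauchy_riemann_shift.
Qed.

(** Only real increments are used, so the mean value theorem applies to the real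
    and imaginary parts on horizontal segments, and uniform continuity of [dh]
    makes the error uniform. *)
Lemma difference_quotient_uniform (h dh : C -> C) (z0 : C) (r s e : R) :
  r < s -> 0 < e ->
  (forall z, in_square z0 s z -> cauchy_riemann h z (dh z)) ->
  (forall z, in_square z0 s z -> continuous_parts dh z) ->
  exists d : R, 0 < d /\ forall t : R, 0 < t < d -> forall z, in_square z0 r z ->
    Cmod (h (z + RtoC t) - h z - RtoC t * dh z)%C <= t * e.
Proof.
  move=> Hrs He Hcr Hc.
  have He2 : 0 < e / 2 by lra.
  have [d1 [Hd1 U1]] := square_uniformly_continuous _ z0 s _ (fun z Hz => proj1 (Hc z Hz)) He2.
  have [d2 [Hd2 U2]] := square_uniformly_continuous _ z0 s _ (fun z Hz => proj2 (Hc z Hz)) He2.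
  exists (Rmin (s - r) (Rmin d1 d2)); split.
  { repeat apply: Rmin_pos => //; lra. }
  move=> t [Ht Htd] [x y] [/= Hx Hy].
  have Ht0 := Rlt_le_trans _ _ _ Htd (Rmin_l _ _).
  have Ht1 := Rlt_le_trans _ _ _ Htd (Rle_trans _ _ _ (Rmin_r _ _) (Rmin_l _ _)).
  have Ht2 := Rlt_le_trans _ _ _ Htd (Rle_trans _ _ _ (Rmin_r _ _) (Rmin_r _ _)).
  have Hs : forall a, x <= a <= x + t -> in_square z0 s (a, y).
  { move=> a Ha; split => /=; last by lra.
    have := Rabs_triang (x - Re z0) (a - x). rewrite (Rabs_right (a - x)); [|lra].
    have -> : x - Re z0 + (a - x) = a - Re z0 by ring. lra. }
  have mvt : forall p : C -> R,
      (forall a, x <= a <= x + t ->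
         is_derive (fun b => p (h (b, y))) a (p (dh (a, y)))) ->
      (forall a, x <= a <= x + t -> Rabs (p (dh (a, y)) - p (dh (x, y))) < e / 2) ->
      Rabs (p (h (x + t, y)) - p (h (x, y)) - t * p (dh (x, y))) <= t * (e / 2).
  { move=> p Hp Hu.
    have [a [Ea Ha]] := MVT_cor2 (fun b => p (h (b, y))) (fun a => p (dh (a, y))) x (x + t)
      ltac:(lra) (fun a Ha => proj1 (is_derive_Reals _ _ _) (Hp a Ha)).
    have -> : p (h (x + t, y)) - p (h (x, y)) - t * p (dh (x, y)) =
              t * (p (dh (a, y)) - p (dh (x, y))) by rewrite Ea; ring.
    rewrite Rabs_mult (Rabs_right t); [|lra].
    apply: Rmult_le_compat_l; [lra|]. left; apply: Hu; lra. }
  have -> : ((x, y) + RtoC t)%C = (x + t, y).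
  { rewrite /Cplus /RtoC /=; congr pair; ring. }
  apply: Rle_trans (Cmod_le_sum _) _.
  have Hxx : in_square z0 s (x, y) by apply: Hs; lra.
  have small : forall a, x <= a <= x + t -> forall d, t < d -> Rabs (a - x) < d.
  { move=> a Ha d Hd. rewrite Rabs_right; lra. }
  have small0 : forall d, 0 < d -> Rabs (y - y) < d.
  { move=> d Hd. by rewrite Rminus_diag Rabs_R0. }
  have := mvt Re (fun a Ha => proj1 (proj1 (Hcr _ (Hs a Ha))))
    (fun a Ha => U1 (x, y) (a, y) Hxx (Hs a Ha) (small a Ha d1 Ht1) (small0 d1 Hd1)).
  have := mvt Im (fun a Ha => proj2 (proj1 (Hcr _ (Hs a Ha))))
    (fun a Ha => U2 (x, y) (a, y) Hxx (Hs a Ha) (small a Ha d2 Ht2) (small0 d2 Hd2)).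
  have ReE : forall a b k : C, Re (a - b - RtoC t * k)%C = Re a - Re b - t * Re k.
  { move=> a b k; rewrite /Re /=; ring. }
  have ImE : forall a b k : C, Im (a - b - RtoC t * k)%C = Im a - Im b - t * Im k.
  { move=> a b k; rewrite /Im /=; ring. }
  rewrite ReE ImE. lra.
Qed.

(** * The weighted function and its critical points *)

Lemma sqmod_ge0 (z : C) : 0 <= sqmod z.
Proof. rewrite /sqmod; nra. Qed.

Lemma sqmod_Cmod (z : C) : sqmod z = Cmod z ^ 2.
Proof. rewrite /sqmod /Cmod pow2_sqrt //; rewrite /Re /Im; nra. Qed.

Lemma holomorphic2_const (k z : C) : holomorphic2 (fun _ => k) z (RtoC 0) (RtoC 0).
Proof.
  exists (fun _ => RtoC 0); split; [|split; [by []|exact: cauchy_riemann_const]].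
  apply: filter_forall => w. exact: cauchy_riemann_const.
Qed.

Definition disc_weight (z0 : C) (r : R) (w : C) : R :=
  r ^ 2 - (Re w - Re z0) ^ 2 - (Im w - Im z0) ^ 2.

Lemma continuous_disc_weight (z0 z : C) (r : R) : continuous (disc_weight z0 r) z.
Proof.
  have sqc : forall (p : C -> R) a, continuous p z -> continuous (fun w => (p w - a) ^ 2) z.
  { move=> p a Hp. apply: (continuous_comp p (fun s => (s - a) ^ 2)) => //.
    apply: ex_derive_continuous; auto_derive => //. }
  have HR : continuous Re z by case: z {sqc} => a b; exact: continuous_fst.
  have HI : continuous Im z by case: z {sqc HR} => a b; exact: continuous_snd.
  apply: (continuous_minus (V := R_NormedModule)); [|exact: sqc].
  apply: (continuous_minus (V := R_NormedModule)); [exact: continuous_const|exact: sqc].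
Qed.

Lemma has_laplacian_ln_disc_weight (z0 z : C) (r : R) :
  0 < disc_weight z0 r z ->
  has_laplacian (fun w => ln (disc_weight z0 r w)) z (- (4 * r ^ 2 / disc_weight z0 r z ^ 2)).
Proof.
  case: z0 z => x0 y0 [x y] Hpos.
  have jet : forall a k t, jet2 (fun s => k - (s - a) ^ 2) t (- (2 * (t - a))) (- 2).
  { move=> a k t; exists (fun s => - (2 * (s - a))); split; [|split; [by []|]].
    - apply: filter_forall => s; auto_derive => //; ring.
    - auto_derive => //; ring. }
  have Hx : jet2 (fun t => disc_weight (x0, y0) r (t, y)) x (- (2 * (x - x0))) (- 2).
  { apply: jet2_ext (jet x0 (r ^ 2 - (y - y0) ^ 2) x) => s; rewrite /disc_weight /=; ring. }
  have Hy : jet2 (fun t => disc_weight (x0, y0) r (x, t)) y (- (2 * (y - y0))) (- 2).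
  { apply: jet2_ext (jet y0 (r ^ 2 - (x - x0) ^ 2) y) => s; rewrite /disc_weight /=; ring. }
  eexists; eexists; eexists; eexists; split; [|split].
  - exact (jet2_ln (fun t => disc_weight (x0, y0) r (t, y)) x _ _ Hpos Hx).
  - exact (jet2_ln (fun t => disc_weight (x0, y0) r (x, t)) y _ _ Hpos Hy).
  - cbv beta. move: Hpos. set q := disc_weight _ _ _ => Hpos.
    have -> : r ^ 2 = q + (x - x0) ^ 2 + (y - y0) ^ 2 by rewrite /q /disc_weight /=; ring.
    field. lra.
Qed.

(** The function maximised in the proof. The truncation of [disc_weight] at 0 makes
    it vanish outside the disc of radius [r], so that its maximum over a square
    around the disc is attained inside the disc. The argument [b] stands for a
    multiple of the coefficient A, and [h1], [h2] for the derivatives of [f1],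
    [f2]. *)
Definition weighted (z0 : C) (r k lam : R) (b f1 f2 h1 h2 : C -> C) (w : C) : R :=
  sqmod (b w) * (k + (sqmod (f1 w) + sqmod (f2 w))) * Rmax 0 (disc_weight z0 r w) ^ 4 *
  exp (lam * (sqmod (h1 w) + sqmod (h2 w))).

Lemma weighted_pos_inv (z0 : C) (r k lam : R) (b f1 f2 h1 h2 : C -> C) (w : C) :
  0 < weighted z0 r k lam b f1 f2 h1 h2 w -> 0 < sqmod (b w) /\ 0 < disc_weight z0 r w.
Proof.
  rewrite /weighted => H; split.
  - case: (sqmod_ge0 (b w)) => // E. move: H; rewrite -E !Rmult_0_l; lra.
  - apply: Rnot_le_lt => Hle. move: H. rewrite Rmax_left // pow_ne_zero //.
    rewrite Rmult_0_r Rmult_0_l; lra.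
Qed.

Lemma ln_weighted (z0 : C) (r k lam : R) (b f1 f2 h1 h2 : C -> C) (w : C) :
  0 < k -> 0 < sqmod (b w) -> 0 < disc_weight z0 r w ->
  ln (weighted z0 r k lam b f1 f2 h1 h2 w) =
  ln (0 + (sqmod (b w) + sqmod (RtoC 0))) + ln (k + (sqmod (f1 w) + sqmod (f2 w))) +
  4 * ln (disc_weight z0 r w) + lam * (sqmod (h1 w) + sqmod (h2 w)).
Proof.
  move=> Hk Hb Hr.
  have Hu : 0 < k + (sqmod (f1 w) + sqmod (f2 w)).
  { have := sqmod_ge0 (f1 w). have := sqmod_ge0 (f2 w). lra. }
  have E0 : 0 + (sqmod (b w) + sqmod (RtoC 0)) = sqmod (b w).
  { rewrite {2}/sqmod /=; ring. }
  rewrite /weighted Rmax_right; [|lra].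
  have H4 : 0 < disc_weight z0 r w ^ 4 by exact: pow_lt.
  have E4 : ln (disc_weight z0 r w ^ 4) = 4 * ln (disc_weight z0 r w) by rewrite ln_pow //=; ring.
  rewrite E0 -E4. move: (disc_weight z0 r w ^ 4) H4 => q H4.
  rewrite ln_mult ?ln_exp; [|by repeat apply: Rmult_lt_0_compat|exact: exp_pos].
  by rewrite ln_mult ?ln_mult //; apply: Rmult_lt_0_compat.
Qed.

(** The second derivative test for the logarithm of [weighted], which is a sum of
    functions with known Laplacians. The factor |b|^2 drops out, since its
    logarithm is harmonic where [b] does not vanish. *)
Lemma weighted_local_max (z0 : C) (r k lam : R) (b f1 f2 h1 h2 : C -> C)
    (p b1 b2 k1 k2 l1 l2 : C) :
  holomorphic2 b p b1 b2 -> continuous (fun w => sqmod (b w)) p ->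
  holomorphic2 f1 p (h1 p) k1 -> holomorphic2 f2 p (h2 p) k2 ->
  holomorphic2 h1 p k1 l1 -> holomorphic2 h2 p k2 l2 ->
  0 < k -> 0 < weighted z0 r k lam b f1 f2 h1 h2 p ->
  locally p (fun w => weighted z0 r k lam b f1 f2 h1 h2 w <=
                      weighted z0 r k lam b f1 f2 h1 h2 p) ->
  4 * (k * (sqmod (h1 p) + sqmod (h2 p)) + sqmod (f1 p * h2 p - h1 p * f2 p)%C) /
    (k + (sqmod (f1 p) + sqmod (f2 p))) ^ 2 +
  lam * (4 * (sqmod k1 + sqmod k2)) <= 4 * (4 * r ^ 2 / disc_weight z0 r p ^ 2).
Proof.
  move=> Hb Hbc Hf1 Hf2 Hh1 Hh2 Hk Hpos Hmax.
  have [Hbp Hrp] := weighted_pos_inv _ _ _ _ _ _ _ _ _ _ Hpos.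
  have Hu : 0 < k + (sqmod (f1 p) + sqmod (f2 p)).
  { have := sqmod_ge0 (f1 p). have := sqmod_ge0 (f2 p). lra. }
  have Hb0 : 0 < 0 + (sqmod (b p) + sqmod (RtoC 0)).
  { have := sqmod_ge0 (RtoC 0). lra. }
  have L1 := has_laplacian_ln_sum_squares 0 _ _ _ _ _ _ _ Hb (holomorphic2_const (RtoC 0) p) Hb0.
  have L2 := has_laplacian_ln_sum_squares k _ _ _ _ _ _ _ Hf1 Hf2 Hu.
  have L3 := has_laplacian_scal 4 _ _ _ (has_laplacian_ln_disc_weight _ _ _ Hrp).
  have L4 := has_laplacian_scal lam _ _ _ (has_laplacian_sum_squares _ _ _ _ _ _ _ Hh1 Hh2).
  have L := has_laplacian_plus _ _ _ _ _
    (has_laplacian_plus _ _ _ _ _ (has_laplacian_plus _ _ _ _ _ L1 L2) L3) L4.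
  have Hloc : locally p (fun w => 0 < sqmod (b w) /\ 0 < disc_weight z0 r w).
  { apply: filter_and.
    - apply: (Hbc (fun s => 0 < s)). exact: open_gt.
    - apply: (continuous_disc_weight z0 p r (fun s => 0 < s)). exact: open_gt. }
  have := has_laplacian_local_max _ _ _ _ L.
  have -> : sqmod (b p * RtoC 0 - b1 * RtoC 0)%C = 0.
  { have -> : (b p * RtoC 0 - b1 * RtoC 0 = RtoC 0)%C by ring.
    rewrite /sqmod /=; ring. }
  have zero : forall X Y : R, 4 * (0 * X + 0) / Y = 0.
  { move=> X Y; rewrite /Rdiv; ring. }
  rewrite zero.
  move=> H. suff : forall a c d : R, 0 + a + 4 * - c + d <= 0 -> a + d <= 4 * c.
  { apply. apply: H. apply: filter_imp (filter_and _ _ Hmax Hloc) => w [Hw [Hw1 Hw2]].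
    rewrite -!ln_weighted //.
    apply: ln_le => //. rewrite /weighted Rmax_right; [|lra].
    have H1 := sqmod_ge0 (f1 w). have H2 := sqmod_ge0 (f2 w).
    have H3 := pow_lt _ 4 Hw2.
    repeat apply: Rmult_lt_0_compat => //; [lra|exact: exp_pos]. }
  move=> a c d; lra.
Qed.

(** The two terms on the left of the hypothesis are nonnegative, so each is bounded
    by the right-hand side. The second gives [A * u * q ^ 2 <= 4 * M ^ 2], which
    suffices when [k <= u]. The first, with [c ^ 2 <= u * v], gives
    [c ^ 2 * q ^ 2 <= 4 * r ^ 2 * (u * (k + u))]; when [u < k] this bounds
    [k * q ^ 2] by a multiple of [u] and reduces to the same estimate. The choice
    [k = c * r] balances the two cases. *)
Lemma critical_point_bound (c k r M q u v A : R) :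
  0 < c -> 0 < r -> 0 < M -> 0 < q <= r ^ 2 -> 0 <= u -> 0 <= v -> 0 <= A ->
  k = c * r -> c ^ 2 <= u * v ->
  4 * (k * v + c ^ 2) / (k + u) ^ 2 + r ^ 2 / M ^ 2 * (4 * (A * u)) <=
    4 * (4 * r ^ 2 / q ^ 2) ->
  A * (k + u) * q ^ 4 <= 64 * r ^ 4 * M ^ 2.
Proof.
  move=> Hc Hr HM [Hq0 Hq] Hu Hv HA Ek Huv H.
  have Hk : 0 < k by rewrite Ek; exact: Rmult_lt_0_compat.
  have Hr2 : 0 < r ^ 2 by exact: pow_lt.
  have HM2 : 0 < M ^ 2 by exact: pow_lt.
  have Hq2 : 0 < q ^ 2 by exact: pow_lt.
  have Hku : 0 < (k + u) ^ 2 by apply: pow_lt; lra.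
  have HAu : 0 <= A * u by exact: Rmult_le_pos.
  have Hkv : 0 <= k * v by apply: Rmult_le_pos; lra.
  have T1 : 0 <= 4 * (k * v + c ^ 2) / (k + u) ^ 2.
  { apply: Rdiv_le_0_compat => //; nra. }
  have T2 : 0 <= r ^ 2 / M ^ 2 * (4 * (A * u)).
  { apply: Rmult_le_pos; [apply: Rdiv_le_0_compat; lra|lra]. }
  have E1 : A * u * q ^ 2 <= 4 * M ^ 2.
  { have {}H : r ^ 2 / M ^ 2 * (4 * (A * u)) <= 4 * (4 * r ^ 2 / q ^ 2) by lra.
    have := Rmult_le_compat_l (M ^ 2 * q ^ 2 / (4 * r ^ 2)) _ _ _ H.
    have -> : M ^ 2 * q ^ 2 / (4 * r ^ 2) * (r ^ 2 / M ^ 2 * (4 * (A * u))) = A * u * q ^ 2.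
    { field; lra. }
    have -> : M ^ 2 * q ^ 2 / (4 * r ^ 2) * (4 * (4 * r ^ 2 / q ^ 2)) = 4 * M ^ 2.
    { field; lra. }
    apply. apply: Rdiv_le_0_compat; nra. }
  have E2 : (k * v + c ^ 2) * q ^ 2 <= 4 * r ^ 2 * (k + u) ^ 2.
  { have {}H : 4 * (k * v + c ^ 2) / (k + u) ^ 2 <= 4 * (4 * r ^ 2 / q ^ 2) by lra.
    have := Rmult_le_compat_l ((k + u) ^ 2 * q ^ 2 / 4) _ _ _ H.
    have -> : (k + u) ^ 2 * q ^ 2 / 4 * (4 * (k * v + c ^ 2) / (k + u) ^ 2) =
              (k * v + c ^ 2) * q ^ 2 by field; lra.
    have -> : (k + u) ^ 2 * q ^ 2 / 4 * (4 * (4 * r ^ 2 / q ^ 2)) = 4 * r ^ 2 * (k + u) ^ 2.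
    { field; lra. }
    apply. apply: Rdiv_le_0_compat; nra. }
  (* multiply the previous bound by [u], use [c ^ 2 <= u * v], and cancel [k + u] *)
  have E3 : c ^ 2 * q ^ 2 <= 4 * r ^ 2 * (u * (k + u)).
  { apply: (Rmult_le_reg_r (k + u)); [lra|].
    have := Rmult_le_compat_l u _ _ Hu E2.
    have : k * c ^ 2 * q ^ 2 <= k * (u * v) * q ^ 2.
    { apply: Rmult_le_compat_r; [lra|]. apply: Rmult_le_compat_l; lra. }
    nra. }
  (* [k + u] is at most twice the larger of the two summands *)
  case: (Rle_lt_dec k u) => Huk.
  - have S1 : A * (k + u) * q ^ 4 <= 2 * (A * u * q ^ 2) * q ^ 2.
    { have -> : 2 * (A * u * q ^ 2) * q ^ 2 = A * (2 * u) * q ^ 4 by ring.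
      apply: Rmult_le_compat_r; [apply: pow_le; lra|].
      apply: Rmult_le_compat_l; lra. }
    have S2 : q ^ 2 <= r ^ 4.
    { have -> : r ^ 4 = (r ^ 2) ^ 2 by ring. apply: pow_incr; lra. }
    have S3 : 2 * (A * u * q ^ 2) * q ^ 2 <= 2 * (4 * M ^ 2) * r ^ 4.
    { apply: Rmult_le_compat; nra. }
    have : 0 < M ^ 2 * r ^ 4 by apply: Rmult_lt_0_compat => //; exact: pow_lt.
    nra.
  - have E4 : k * q ^ 2 <= 8 * r ^ 4 * u.
    { have S : c * (k * q ^ 2) <= c * (8 * r ^ 4 * u).
      { have : c ^ 2 * q ^ 2 <= 8 * r ^ 2 * (u * k) by nra.
        move/(Rmult_le_compat_l r _ _ (Rlt_le _ _ Hr)).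
        rewrite Ek. nra. }
      exact: Rmult_le_reg_l S. }
    have S1 : A * (k + u) * q ^ 4 <= 2 * A * q ^ 2 * (k * q ^ 2).
    { have -> : 2 * A * q ^ 2 * (k * q ^ 2) = A * (2 * k) * q ^ 4 by ring.
      apply: Rmult_le_compat_r; [apply: pow_le; lra|].
      apply: Rmult_le_compat_l; lra. }
    have S2 : 2 * A * q ^ 2 * (k * q ^ 2) <= 2 * A * q ^ 2 * (8 * r ^ 4 * u).
    { apply: Rmult_le_compat_l => //; nra. }
    have Hr4 : 0 < r ^ 4 by exact: pow_lt.
    have S3 : 16 * r ^ 4 * (A * u * q ^ 2) <= 16 * r ^ 4 * (4 * M ^ 2).
    { apply: Rmult_le_compat_l; lra. }
    lra.
Qed.

(** * Geometry and continuity in the disc *)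

Lemma sqmod_mult (z w : C) : sqmod (z * w)%C = sqmod z * sqmod w.
Proof. rewrite /sqmod /Re /Im /=; ring. Qed.

Lemma sqmod_plus_le (z w : C) : sqmod (z + w)%C <= 2 * sqmod z + 2 * sqmod w.
Proof.
  case: z w => a b [c d]; rewrite /sqmod /=.
  have := pow2_ge_0 (a - c). have := pow2_ge_0 (b - d). lra.
Qed.

Lemma sqmod_le (z : C) (a : R) : Cmod z <= a -> sqmod z <= a ^ 2.
Proof.
  move=> H; rewrite sqmod_Cmod; apply: pow_incr; split => //; exact: Cmod_ge_0.
Qed.

(** The constant 5/4 is admissible because 5/4 times the square root of 2 is less
    than 2; being larger than 1, it leaves room for a horizontal shift. *)
Lemma in_square_unit_disc (z0 z : C) (r : R) :
  0 < r -> Cmod z0 + 2 * r <= 1 -> in_square z0 (5 / 4 * r) z -> unit_disc z.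
Proof.
  move=> Hr H [H1 H2].
  have Hd : Cmod (z - z0)%C < 2 * r.
  { apply: Rnot_le_lt => Hle.
    have : (2 * r) ^ 2 <= sqmod (z - z0)%C by rewrite sqmod_Cmod; apply: pow_incr; lra.
    have := pow_incr _ _ 2 (conj (Rabs_pos _) H1).
    have := pow_incr _ _ 2 (conj (Rabs_pos _) H2).
    rewrite !pow2_abs.
    have -> : sqmod (z - z0)%C = (Re z - Re z0) ^ 2 + (Im z - Im z0) ^ 2.
    { rewrite /sqmod /Re /Im /=; ring. }
    have := pow_lt r 2 Hr. nra. }
  have := Cmod_triangle (z - z0) z0.
  have -> : (z - z0 + z0 = z)%C by ring.
  rewrite /unit_disc; lra.
Qed.

Lemma disc_weight_pos_in_square (z0 z : C) (r : R) :
  0 < r -> 0 < disc_weight z0 r z ->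
  (Rabs (Re z - Re z0) < r /\ Rabs (Im z - Im z0) < r) /\ Cmod (z - z0)%C < r.
Proof.
  rewrite /disc_weight => Hr H.
  have sqlt : forall x, x ^ 2 < r ^ 2 -> Rabs x < r.
  { move=> x Hx. rewrite -(Rabs_right r); [|lra]. apply: Rsqr_lt_abs_0; rewrite /Rsqr; lra. }
  have H1 := pow2_ge_0 (Re z - Re z0). have H2 := pow2_ge_0 (Im z - Im z0).
  split; [split; apply: sqlt; lra|].
  rewrite -(Rabs_right (Cmod _)); last by apply: Rle_ge; exact: Cmod_ge_0.
  apply: sqlt; rewrite -sqmod_Cmod.
  have -> : sqmod (z - z0)%C = (Re z - Re z0) ^ 2 + (Im z - Im z0) ^ 2.
  { rewrite /sqmod /Re /Im /=; ring. }
  lra.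
Qed.

Lemma locally_in_square (z0 p : C) (r : R) :
  Rabs (Re p - Re z0) < r /\ Rabs (Im p - Im z0) < r ->
  locally p (fun w => in_square z0 r w).
Proof.
  move=> [H1 H2].
  have He : 0 < Rmin (r - Rabs (Re p - Re z0)) (r - Rabs (Im p - Im z0)).
  { apply: Rmin_pos; lra. }
  exists (mkposreal _ He) => w [W1 W2].
  have {}W1 : Rabs (Re w - Re p) < r - Rabs (Re p - Re z0).
  { exact: Rlt_le_trans W1 (Rmin_l _ _). }
  have {}W2 : Rabs (Im w - Im p) < r - Rabs (Im p - Im z0).
  { exact: Rlt_le_trans W2 (Rmin_r _ _). }
  split.
  - have := Rabs_triang (Re w - Re p) (Re p - Re z0).
    have -> : Re w - Re p + (Re p - Re z0) = Re w - Re z0 by ring. lra.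
  - have := Rabs_triang (Im w - Im p) (Im p - Im z0).
    have -> : Im w - Im p + (Im p - Im z0) = Im w - Im z0 by ring. lra.
Qed.

Lemma continuous_sqmod (f : C -> C) (z : C) :
  continuous_parts f z -> continuous (fun w => sqmod (f w)) z.
Proof.
  move=> [H1 H2].
  have c2 : forall p : C -> R, continuous p z -> continuous (fun w => p w ^ 2) z.
  { move=> p Hp. apply: (continuous_comp p (fun s => s ^ 2)) => //.
    apply: ex_derive_continuous; auto_derive => //. }
  apply: (continuous_plus (V := R_NormedModule)); exact: c2.
Qed.

Lemma continuous_weighted (z0 : C) (r k lam : R) (b f1 f2 h1 h2 : C -> C) (z : C) :
  continuous (fun w => sqmod (b w)) z ->
  continuous (fun w => sqmod (f1 w)) z -> continuous (fun w => sqmod (f2 w)) z ->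
  continuous (fun w => sqmod (h1 w)) z -> continuous (fun w => sqmod (h2 w)) z ->
  continuous (weighted z0 r k lam b f1 f2 h1 h2) z.
Proof.
  move=> Hb Hf1 Hf2 Hh1 Hh2.
  apply: continuous_Rmult; [apply: continuous_Rmult; [apply: continuous_Rmult|]|].
  - exact: Hb.
  - apply: continuous_Rplus; [exact: continuous_const|exact: continuous_Rplus].
  - have Hm : continuous (fun w => Rmax 0 (disc_weight z0 r w)) z.
    { apply: (continuous_ext (fun w => / 2 * (disc_weight z0 r w + Rabs (disc_weight z0 r w)))).
      { move=> w. case: (Rle_lt_dec 0 (disc_weight z0 r w)) => H.
        - rewrite Rmax_right // Rabs_right; lra.
        - rewrite Rmax_left ?Rabs_left; lra. }
      apply: continuous_Rmult; [exact: continuous_const|].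
      apply: continuous_Rplus; [exact: continuous_disc_weight|].
      apply: (continuous_comp (disc_weight z0 r) Rabs); [exact: continuous_disc_weight|exact: continuous_Rabs]. }
    apply: (continuous_comp _ (fun s => s ^ 4) z Hm).
    apply: ex_derive_continuous; auto_derive => //.
  - have Hl : continuous (fun w => lam * (sqmod (h1 w) + sqmod (h2 w))) z.
    { apply: continuous_Rmult; [exact: continuous_const|exact: continuous_Rplus]. }
    apply: (continuous_comp _ exp z Hl).
    apply: ex_derive_continuous; auto_derive => //.
Qed.

(** The Cauchy-Schwarz inequality for the pair formed by (a1, a2) and the conjugate
    of (b2, -b1), as a sum of two squares. *)
Lemma lagrange_identity_le (a1 a2 b1 b2 : C) :
  sqmod (a1 * b2 - b1 * a2)%C <= (sqmod a1 + sqmod a2) * (sqmod b1 + sqmod b2).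
Proof.
  case: a1 a2 b1 b2 => x1 y1 [x2 y2] [u1 v1] [u2 v2].
  rewrite /sqmod /Re /Im /=.
  have := pow2_ge_0 (x1 * u1 + y1 * v1 + x2 * u2 + y2 * v2).
  have := pow2_ge_0 (x1 * v1 - y1 * u1 + x2 * v2 - y2 * u2).
  lra.
Qed.

(** * The estimate at a point of the disc *)

(** Divided by [t] this approximates h1 h2' - h2 h1', but it has as many
    derivatives as [h1] and [h2] themselves. *)
Definition shifted_wronskian (h1 h2 : C -> C) (t : R) (w : C) : C :=
  (h1 w * h2 (w + RtoC t) - h2 w * h1 (w + RtoC t))%C.

Lemma shifted_wronskian_close (h1 h2 : C -> C) (t : R) (w k1 k2 : C) (B e : R) :
  0 <= B -> Cmod (h1 w) <= B -> Cmod (h2 w) <= B ->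
  Cmod (h1 (w + RtoC t) - h1 w - RtoC t * k1)%C <= e ->
  Cmod (h2 (w + RtoC t) - h2 w - RtoC t * k2)%C <= e ->
  Cmod (shifted_wronskian h1 h2 t w - RtoC t * (h1 w * k2 - h2 w * k1))%C <= 2 * B * e.
Proof.
  move=> HB H1 H2 E1 E2.
  have -> : (shifted_wronskian h1 h2 t w - RtoC t * (h1 w * k2 - h2 w * k1) =
    h1 w * (h2 (w + RtoC t) - h2 w - RtoC t * k2) +
    - (h2 w * (h1 (w + RtoC t) - h1 w - RtoC t * k1)))%C.
  { rewrite /shifted_wronskian; ring. }
  apply: Rle_trans (Cmod_triangle _ _) _.
  rewrite Cmod_opp !Cmod_mult.
  have := Rmult_le_compat _ _ _ _ (Cmod_ge_0 _) (Cmod_ge_0 _) H1 E2.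
  have := Rmult_le_compat _ _ _ _ (Cmod_ge_0 _) (Cmod_ge_0 _) H2 E1.
  lra.
Qed.

(** Here [b] may be any twice differentiable function: the coefficient [A] enters
    only through the values - A F_j of the second derivatives, that is, through
    the Laplacian of |H1|^2 + |H2|^2. *)
Lemma weighted_le_at_maximum (c A z0 p b1 b2 l1 l2 : C) (b F1 F2 H1 H2 : C -> C)
    (r M : R) :
  c <> RtoC 0 -> 0 < r -> 0 < M ->
  holomorphic2 b p b1 b2 -> continuous (fun w => sqmod (b w)) p ->
  holomorphic2 F1 p (H1 p) (- (A * F1 p))%C -> holomorphic2 F2 p (H2 p) (- (A * F2 p))%C ->
  holomorphic2 H1 p (- (A * F1 p))%C l1 -> holomorphic2 H2 p (- (A * F2 p))%C l2 ->
  (F1 p * H2 p - H1 p * F2 p)%C = c ->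
  (0 < disc_weight z0 r p -> Cmod (H1 p) <= M / r /\ Cmod (H2 p) <= M / r) ->
  let W := weighted z0 r (Cmod c * r) (r ^ 2 / M ^ 2) b F1 F2 H1 H2 in
  0 < W p -> locally p (fun w => W w <= W p) ->
  sqmod A * (Cmod c * r + (sqmod (F1 p) + sqmod (F2 p))) * Rmax 0 (disc_weight z0 r p) ^ 4 <= 64 * r ^ 4 * M ^ 2
  /\ exp (r ^ 2 / M ^ 2 * (sqmod (H1 p) + sqmod (H2 p))) <= 9.
Proof.
  move=> Hc Hr HM Hb Hbc HF1 HF2 HH1 HH2 EW Hbnd W Hpos Hmax.
  have Hc0 : 0 < Cmod c by apply/Cmod_gt_0.
  have Hk : 0 < Cmod c * r by exact: Rmult_lt_0_compat.
  have [_ Hrho] := weighted_pos_inv _ _ _ _ _ _ _ _ _ _ Hpos.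
  have HL := weighted_local_max _ _ _ _ _ _ _ _ _ _ _ _ _ _ _ _ Hb Hbc HF1 HF2 HH1 HH2 Hk Hpos Hmax.
  have U1 := sqmod_ge0 (F1 p). have U2 := sqmod_ge0 (F2 p).
  have V1 := sqmod_ge0 (H1 p). have V2 := sqmod_ge0 (H2 p).
  have r2 := pow_lt r 2 Hr. have M2 := pow_lt M 2 HM.
  split.
  - rewrite Rmax_right; [|lra].
    apply: (critical_point_bound (Cmod c) (Cmod c * r) r M (disc_weight z0 r p)
      (sqmod (F1 p) + sqmod (F2 p)) (sqmod (H1 p) + sqmod (H2 p))) => //; try lra.
    + split=> //. rewrite /disc_weight. have := pow2_ge_0 (Re p - Re z0).
      have := pow2_ge_0 (Im p - Im z0). lra.
    + exact: sqmod_ge0.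
    + rewrite -sqmod_Cmod -EW. exact: lagrange_identity_le.
    + move: HL. rewrite EW.
      have sqN : forall z w, sqmod (- (z * w))%C = sqmod z * sqmod w.
      { move=> z w; rewrite -sqmod_mult /sqmod /Re /Im /=; ring. }
      by rewrite !sqN (sqmod_Cmod c) -Rmult_plus_distr_l.
  - have [B1 B2] := Hbnd Hrho.
    have {}B1 := sqmod_le _ _ B1. have {}B2 := sqmod_le _ _ B2.
    have Hle : r ^ 2 / M ^ 2 * (sqmod (H1 p) + sqmod (H2 p)) <= 1 + 1.
    { have -> : 1 + 1 = r ^ 2 / M ^ 2 * ((M / r) ^ 2 + (M / r) ^ 2) by field; lra.
      apply: Rmult_le_compat_l; [apply: Rdiv_le_0_compat; lra|lra]. }
    have := exp_le_3. have := exp_pos 1.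
    have : exp (r ^ 2 / M ^ 2 * (sqmod (H1 p) + sqmod (H2 p))) <= exp 1 * exp 1.
    { rewrite -exp_plus. case: Hle => [Hlt|->]; [left; exact: exp_increasing|right; reflexivity]. }
    nra.
Qed.

(** Compares [weighted], with [b] a shifted Wronskian approximating [t * c * A], at
    [z0] and at its maximum. The factor 2401 = 49^2 absorbs 64 e^2 and the losses
    from replacing [A] by its approximation and back. *)
Lemma solution_pair_bound (c : C) (A dA f1 f2 h1 h2 : C -> C) (z0 : C) (r M : R) :
  c <> RtoC 0 -> 0 < M -> 0 < r -> Cmod z0 + 2 * r <= 1 ->
  derivative_in_disc A dA ->
  derivative_in_disc f1 h1 -> derivative_in_disc f2 h2 ->
  derivative_in_disc h1 (fun w => - (A w * f1 w))%C ->
  derivative_in_disc h2 (fun w => - (A w * f2 w))%C ->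
  (forall z, unit_disc z -> (f1 z * h2 z - h1 z * f2 z)%C = c) ->
  (forall z, unit_disc z -> Cmod (h1 z) * (1 - Cmod z ^ 2) <= M) ->
  (forall z, unit_disc z -> Cmod (h2 z) * (1 - Cmod z ^ 2) <= M) ->
  sqmod (A z0) * Cmod c * r ^ 5 <= 2401 * M ^ 2.
Proof.
  move=> Hc HM Hr Hz0 DA D1 D2 DD1 DD2 HW HM1 HM2.
  have Hdisc : forall s z, s <= 5 / 4 * r -> in_square z0 s z -> unit_disc z.
  { move=> s z Hs [Q1 Q2]. apply: (in_square_unit_disc z0 z r) => //; split; lra. }
  set kap := Cmod c * r.
  have Hc0 : 0 < Cmod c by apply/Cmod_gt_0.
  have Hk : 0 < kap by exact: Rmult_lt_0_compat.
  have sqc : forall f df z, derivative_in_disc f df -> unit_disc z -> continuous (fun w => sqmod (f w)) z.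
  { move=> f df z D Hz; apply: continuous_sqmod; exact: derivative_in_disc_continuous D Hz. }
  have z0sq : forall s, 0 < s -> in_square z0 s z0.
  { move=> s Hs; split; rewrite Rminus_diag Rabs_R0; lra. }
  have [U [HU0 HU]] : exists U, 0 <= U /\
      forall z, in_square z0 r z -> sqmod (f1 z) + sqmod (f2 z) <= U.
  { have [|z Hz|q [_ Hq]] := square_maximum (fun z => sqmod (f1 z) + sqmod (f2 z)) z0 r (9 / 8 * r).
    - lra.
    - have Hd : unit_disc z by apply: Hdisc Hz; lra.
      apply: continuous_Rplus; [exact: sqc D1 Hd|exact: sqc D2 Hd].
    - exists (sqmod (f1 q) + sqmod (f2 q)); split=> //.
      have := sqmod_ge0 (f1 q). have := sqmod_ge0 (f2 q). lra. }
  (* the value of [e] is dictated by [He2] below: the error made in replacing [A]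
     must stay below the main term of size [r ^ 4 * M ^ 2] *)
  pose e := M / (r ^ 2 * (1 + kap + U)).
  have Hr2 : 0 < r ^ 2 by exact: pow_lt.
  have He : 0 < e by apply: Rdiv_lt_0_compat => //; apply: Rmult_lt_0_compat => //; lra.
  have He2 : e ^ 2 * (kap + U) * r ^ 4 <= M ^ 2.
  { have -> : e ^ 2 * (kap + U) * r ^ 4 = M ^ 2 * ((kap + U) / (1 + kap + U) ^ 2).
    { rewrite /e; field; lra. }
    rewrite -{2}(Rmult_1_r (M ^ 2)). apply: Rmult_le_compat_l; [exact: pow2_ge_0|].
    apply/Rle_div_l; [apply: pow_lt; lra|nra]. }
  (* makes the error [2 * (M / r) * (t * e')] of the shifted Wronskian equal to [t * Cmod c * e] *)
  pose e' := e * r * Cmod c / (2 * M).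
  have He' : 0 < e'.
  { apply: Rdiv_lt_0_compat; [|lra]. repeat apply: Rmult_lt_0_compat => //. }
  have quot : forall f h, derivative_in_disc f h -> derivative_in_disc h (fun w => - (A w * f w))%C ->
     exists d : R, 0 < d /\ forall t : R, 0 < t < d -> forall z, in_square z0 r z ->
       Cmod (h (z + RtoC t) - h z - RtoC t * - (A z * f z))%C <= t * e'.
  { move=> f h Df Dh; apply: (difference_quotient_uniform h (fun w => - (A w * f w))%C z0 r (5 / 4 * r)) => //.
    - lra.
    - move=> z Hz; apply: (derivative_in_disc_cauchy_riemann _ _ _ Dh); apply: Hdisc Hz; lra.
    - move=> z Hz. have Hd : unit_disc z by apply: Hdisc Hz; lra.
      apply: continuous_parts_opp; apply: continuous_parts_mult.
      + exact: derivative_in_disc_continuous DA Hd.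
      + exact: derivative_in_disc_continuous Df Hd. }
  have [d1 [Hd1 Q1]] := quot _ _ D1 DD1.
  have [d2 [Hd2 Q2]] := quot _ _ D2 DD2.
  (* [t < r / 8] keeps the shift of the square of half-side 9/8 r inside the one of half-side 5/4 r *)
  have [t [Ht [Ht1 [Ht2 Htr]]]] : exists t, 0 < t /\ t < d1 /\ t < d2 /\ t < r / 8.
  { have m1 := Rmin_l d1 (Rmin d2 (r / 8)). have m2 := Rmin_r d1 (Rmin d2 (r / 8)).
    have m3 := Rmin_l d2 (r / 8). have m4 := Rmin_r d2 (r / 8).
    have : 0 < Rmin d1 (Rmin d2 (r / 8)) by repeat apply: Rmin_pos => //; lra.
    exists (Rmin d1 (Rmin d2 (r / 8)) / 2); lra. }
  pose b := shifted_wronskian h1 h2 t.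
  have hbound : forall z, 0 < disc_weight z0 r z -> Cmod (h1 z) <= M / r /\ Cmod (h2 z) <= M / r.
  { move=> z Hz. have [_ Hd] := disc_weight_pos_in_square _ _ _ Hr Hz.
    have Hle : r <= 1 - Cmod z ^ 2 /\ unit_disc z.
    { have := Cmod_triangle (z - z0) z0.
      have -> : (z - z0 + z0 = z)%C by ring. rewrite /unit_disc => Ht3.
      have := Cmod_ge_0 z. split; nra. }
    case: Hle => Hle Hz1.
    have aux : forall h : C -> C, Cmod (h z) * (1 - Cmod z ^ 2) <= M -> Cmod (h z) <= M / r.
    { move=> h H; apply/Rle_div_r => //. apply: Rle_trans H.
      apply: Rmult_le_compat_l => //; exact: Cmod_ge_0. }
    split; apply: aux; [exact: HM1|exact: HM2]. }
  have close : forall z, 0 < disc_weight z0 r z ->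
      sqmod (b z - RtoC t * (c * A z))%C <= (t * Cmod c * e) ^ 2.
  { move=> z Hz. have [[s1 s2] Hd] := disc_weight_pos_in_square _ _ _ Hr Hz.
    have Hsq : in_square z0 r z by split; lra.
    have Hz1 : unit_disc z by apply: Hdisc Hsq; lra.
    have [B1 B2] := hbound z Hz.
    apply: sqmod_le.
    have -> : (c * A z = h1 z * - (A z * f2 z) - h2 z * - (A z * f1 z))%C.
    { rewrite -(HW z Hz1); ring. }
    have -> : t * Cmod c * e = 2 * (M / r) * (t * e').
    { rewrite /e'; field; lra. }
    apply: shifted_wronskian_close => //.
    - left; exact: Rdiv_lt_0_compat.
    - exact: Q1.
    - exact: Q2. }
  have shift_disc : forall z, in_square z0 (9 / 8 * r) z -> unit_disc (z + RtoC t)%C.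
  { move=> [x y] [/= S1 S2]; apply: (Hdisc (5 / 4 * r)); [lra|]; split => /=.
    - have -> : x + t - Re z0 = x - Re z0 + t by ring.
      apply: Rle_trans (Rabs_triang _ _) _. rewrite (Rabs_right t); lra.
    - rewrite Rplus_0_r; lra. }
  have cont_b : forall z, in_square z0 (9 / 8 * r) z -> continuous (fun w => sqmod (b w)) z.
  { move=> z Hz.
    have Hd : unit_disc z by apply: Hdisc Hz; lra.
    have Hd' := shift_disc z Hz.
    apply: continuous_sqmod; apply: continuous_parts_minus; apply: continuous_parts_mult.
    - exact: derivative_in_disc_continuous DD1 Hd.
    - apply: continuous_parts_shift; exact: derivative_in_disc_continuous DD2 Hd'.
    - exact: derivative_in_disc_continuous DD2 Hd.
    - apply: continuous_parts_shift; exact: derivative_in_disc_continuous DD1 Hd'. }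
  pose lam := r ^ 2 / M ^ 2.
  pose W := weighted z0 r kap lam b f1 f2 h1 h2.
  have [|z Hz|p [Hp Hmax]] := square_maximum W z0 r (9 / 8 * r).
  { lra. }
  { have Hd : unit_disc z by apply: Hdisc Hz; lra.
    apply: continuous_weighted.
    - exact: cont_b.
    - exact: sqc D1 Hd.
    - exact: sqc D2 Hd.
    - exact: sqc DD1 Hd.
    - exact: sqc DD2 Hd. }
  have tc2 : 0 < (t * Cmod c) ^ 2 by apply: pow_lt; exact: Rmult_lt_0_compat.
  have sqtc : forall a, sqmod (RtoC t * (c * a))%C = (t * Cmod c) ^ 2 * sqmod a.
  { move=> a; rewrite !sqmod_mult (sqmod_Cmod c).
    have -> : sqmod (RtoC t) = t ^ 2 by rewrite /sqmod /=; ring. ring. }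
  have bound_p : W p <= 9 * (2 * (t * Cmod c) ^ 2 * (65 * r ^ 4 * M ^ 2)).
  { case: (Rle_lt_dec (W p) 0) => HWp.
    { apply: Rle_trans HWp _.
      have := pow2_ge_0 M. have := pow2_ge_0 (r ^ 2). have -> : (r ^ 2) ^ 2 = r ^ 4 by ring.
      move=> q1 q2. have := Rmult_le_pos _ _ (Rlt_le _ _ tc2) (Rmult_le_pos _ _ q1 q2). lra. }
    have [_ Hrho] := weighted_pos_inv _ _ _ _ _ _ _ _ _ _ HWp.
    have [[s1 s2] _] := disc_weight_pos_in_square _ _ _ Hr Hrho.
    have Hpd : unit_disc p by apply: Hdisc Hp; lra.
    have hol1 : forall f h, derivative_in_disc f h ->
        derivative_in_disc h (fun w => - (A w * f w))%C ->
        forall z, unit_disc z -> holomorphic2 f z (h z) (- (A z * f z))%C.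
    { move=> f h D DD z Hz; apply: derivative_in_disc_holomorphic2 => //.
      exact: derivative_in_disc_cauchy_riemann DD Hz. }
    have hol2 : forall f h, derivative_in_disc f h ->
        derivative_in_disc h (fun w => - (A w * f w))%C ->
        forall z, unit_disc z -> exists l, holomorphic2 h z (- (A z * f z))%C l.
    { move=> f h D DD z Hz; eexists.
      apply: (derivative_in_disc_holomorphic2 h (fun w => - (A w * f w))%C) => //.
      apply: cauchy_riemann_opp; apply: cauchy_riemann_mult.
      - exact: derivative_in_disc_cauchy_riemann DA Hz.
      - exact: derivative_in_disc_cauchy_riemann D Hz. }
    have [l1 Hl1] := hol2 _ _ D1 DD1 p Hpd. have [l2 Hl2] := hol2 _ _ D2 DD2 p Hpd.
    have Hp98 : in_square z0 (9 / 8 * r) p by case: Hp => *; split; lra.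
    have Hpt := shift_disc p Hp98.
    have [l1' Hl1'] := hol2 _ _ D1 DD1 _ Hpt. have [l2' Hl2'] := hol2 _ _ D2 DD2 _ Hpt.
    (* the second derivative of the shifted Wronskian exists because [h1] and [h2] have two *)
    have Hb := holomorphic2_minus _ _ _ _ _ _ _
      (holomorphic2_mult _ _ _ _ _ _ _ Hl1 (holomorphic2_shift _ _ _ _ _ Hl2'))
      (holomorphic2_mult _ _ _ _ _ _ _ Hl2 (holomorphic2_shift _ _ _ _ _ Hl1')).
    have Hloc : locally p (fun w => W w <= W p).
    { apply: filter_imp (locally_in_square z0 p r (conj s1 s2)) => w. exact: Hmax. }
    have [P1 P2] := weighted_le_at_maximum c (A p) z0 p _ _ l1 l2 b f1 f2 h1 h2 r M
      Hc Hr HM Hb (cont_b p Hp98) (hol1 _ _ D1 DD1 p Hpd) (hol1 _ _ D2 DD2 p Hpd) Hl1 Hl2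
      (HW p Hpd) (hbound p) HWp Hloc.
    have Hsb : sqmod (b p) <= 2 * (t * Cmod c) ^ 2 * (sqmod (A p) + e ^ 2).
    { have := sqmod_plus_le (b p - RtoC t * (c * A p)) (RtoC t * (c * A p)).
      have -> : (b p - RtoC t * (c * A p) + RtoC t * (c * A p) = b p)%C by ring.
      have := close p Hrho. rewrite sqtc Rpow_mult_distr. lra. }
    have HUp := HU p Hp.
    have Q := Rmax_right 0 (disc_weight z0 r p) (Rlt_le _ _ Hrho).
    have Hq : 0 < disc_weight z0 r p <= r ^ 2.
    { split=> //. rewrite /disc_weight. have := pow2_ge_0 (Re p - Re z0).
      have := pow2_ge_0 (Im p - Im z0). lra. }
    have Hq4 : disc_weight z0 r p ^ 4 <= r ^ 8.
    { have -> : r ^ 8 = (r ^ 2) ^ 4 by ring. apply: pow_incr; lra. }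
    have Hq40 : 0 < disc_weight z0 r p ^ 4 by apply: pow_lt; lra.
    have u1 := sqmod_ge0 (f1 p). have u2 := sqmod_ge0 (f2 p).
    have E2 : e ^ 2 * (kap + (sqmod (f1 p) + sqmod (f2 p))) * disc_weight z0 r p ^ 4 <= r ^ 4 * M ^ 2.
    { have He0 := pow2_ge_0 e.
      apply: (Rle_trans _ (e ^ 2 * (kap + U) * r ^ 8)).
      - apply: Rmult_le_compat; [apply: Rmult_le_pos; lra|lra| |lra].
        apply: Rmult_le_compat_l; lra.
      - have -> : e ^ 2 * (kap + U) * r ^ 8 = r ^ 4 * (e ^ 2 * (kap + U) * r ^ 4) by ring.
        apply: Rmult_le_compat_l => //. left; exact: pow_lt. }
    rewrite Q -/kap in P1.
    rewrite /W /weighted Q (Rmult_comm 9).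
    apply: Rmult_le_compat; [|left; exact: exp_pos| |exact: P2].
    - apply: Rmult_le_pos; [apply: Rmult_le_pos; [exact: sqmod_ge0|lra]|lra].
    - apply: (Rle_trans _ (2 * (t * Cmod c) ^ 2 * (sqmod (A p) + e ^ 2) *
          (kap + (sqmod (f1 p) + sqmod (f2 p))) * disc_weight z0 r p ^ 4)).
      + apply: Rmult_le_compat_r; [lra|]. apply: Rmult_le_compat_r; [lra|exact: Hsb].
      + have := Rmult_le_compat_l _ _ _ (Rlt_le _ _ tc2) P1.
        have := Rmult_le_compat_l _ _ _ (Rlt_le _ _ tc2) E2. lra. }
  have H0 := Rle_trans _ _ _ (Hmax z0 (z0sq r Hr)) bound_p.
  have rho0 : disc_weight z0 r z0 = r ^ 2 by rewrite /disc_weight; ring.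
  have lower : sqmod (b z0) * kap * r ^ 8 <= W z0.
  { rewrite /W /weighted rho0 Rmax_right; [|lra].
    have -> : (r ^ 2) ^ 4 = r ^ 8 by ring.
    have r8 := pow_lt r 8 Hr.
    have u1 := sqmod_ge0 (f1 z0). have u2 := sqmod_ge0 (f2 z0). have sb := sqmod_ge0 (b z0).
    rewrite -{1}(Rmult_1_r (sqmod (b z0) * kap * r ^ 8)).
    apply: Rmult_le_compat; [|lra| |].
    - repeat apply: Rmult_le_pos => //; lra.
    - apply: Rmult_le_compat_r; [lra|]. apply: Rmult_le_compat_l; lra.
    - set x := _ * _. suff Hx : 0 <= x by have := exp_ineq1_le x; lra.
      apply: Rmult_le_pos.
      + apply: Rdiv_le_0_compat; [lra|exact: pow_lt].
      + have := sqmod_ge0 (h1 z0). have := sqmod_ge0 (h2 z0). lra. }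
  have Hz0d : 0 < disc_weight z0 r z0 by rewrite rho0.
  have upper : (t * Cmod c) ^ 2 * sqmod (A z0) <= 2 * sqmod (b z0) + 2 * (t * Cmod c) ^ 2 * e ^ 2.
  { have := sqmod_plus_le (b z0) (- (b z0 - RtoC t * (c * A z0)))%C.
    have -> : (b z0 + - (b z0 - RtoC t * (c * A z0)) = RtoC t * (c * A z0))%C by ring.
    have -> : forall a, sqmod (- a)%C = sqmod a by move=> a; rewrite /sqmod /Re /Im /=; ring.
    have := close z0 Hz0d. rewrite sqtc Rpow_mult_distr. lra. }
  have kr8 : 0 < kap * r ^ 8 by apply: Rmult_lt_0_compat => //; exact: pow_lt.
  have E3 : e ^ 2 * (kap * r ^ 8) <= r ^ 4 * M ^ 2.
  { apply: (Rle_trans _ (r ^ 4 * (e ^ 2 * (kap + U) * r ^ 4))).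
    - have -> : r ^ 4 * (e ^ 2 * (kap + U) * r ^ 4) =
          e ^ 2 * (kap * r ^ 8) + e ^ 2 * (U * r ^ 8) by ring.
      have := Rmult_le_pos _ _ (pow2_ge_0 e) (Rmult_le_pos _ _ HU0 (Rlt_le _ _ (pow_lt r 8 Hr))).
      lra.
    - apply: Rmult_le_compat_l => //. left; exact: pow_lt. }
  have final : (t * Cmod c) ^ 2 * (sqmod (A z0) * (kap * r ^ 8)) <=
               (t * Cmod c) ^ 2 * (2342 * (r ^ 4 * M ^ 2)).
  { have S1 := Rmult_le_compat_r _ _ _ (Rlt_le _ _ kr8) upper.
    have S2 := Rmult_le_compat_l _ _ _ (Rlt_le _ _ tc2) E3.
    lra. }
  have {}final := Rmult_le_reg_l _ _ _ tc2 final.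
  have r4 := pow_lt r 4 Hr.
  apply: (Rmult_le_reg_l (r ^ 4)) => //.
  have -> : r ^ 4 * (sqmod (A z0) * Cmod c * r ^ 5) = sqmod (A z0) * (kap * r ^ 8).
  { rewrite /kap; ring. }
  have := Rmult_lt_0_compat _ _ r4 (pow_lt M 2 HM). lra.
Qed.

(** * Bloch seminorms and the conclusion *)

Lemma derivative_in_disc_C_derive (f : C -> C) :
  analytic_in_disc f -> derivative_in_disc f (C_derive f).
Proof. move=> H z Hz. exact: C_derive_correct (H z Hz). Qed.

(** The value at 0 shows that the supremum is not over an empty set, so it cannot be minus infinity. *)
Lemma bloch_seminorm_finite (f : C -> C) :
  Rbar_lt (bloch_seminorm f) p_infty ->
  exists m : R, bloch_seminorm f = Finite m /\
    forall z, unit_disc z -> Cmod (C_derive f z) * (1 - Cmod z ^ 2) <= m.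
Proof.
  have [Hub _] := Lub_Rbar_correct
    (fun x : R => exists z, unit_disc z /\ x = Cmod (C_derive f z) * (1 - Cmod z ^ 2)).
  have H0 : unit_disc (RtoC 0) by rewrite /unit_disc Cmod_0; lra.
  move: Hub; rewrite /bloch_seminorm /disc_sup.
  case: (Lub_Rbar _) => [m| |] Hub Hlt.
  - exists m; split => // z Hz. by apply: (Hub _); exists z.
  - by [].
  - case: (Hub _ (ex_intro _ _ (conj H0 (eq_refl _)))).
Qed.

Lemma Rpower_5_2_sqr (x : R) : 0 < x -> Rpower x (5 / 2) ^ 2 = x ^ 5.
Proof.
  move=> Hx. rewrite -(Rpower_pow 5 x Hx) /= Rmult_1_r -Rpower_plus.
  congr Rpower; field.
Qed.

(** [solution_pair_bound] with r = (1 - |z|)/2, using 1 - |z|^2 <= 4 r; the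
    constant is the square root of 4^5 * 2401 / |c|. *)
Lemma solution_pair_pointwise (c : C) (A f1 f2 : C -> C) (M : R) (z : C) :
  c <> RtoC 0 -> 0 < M -> analytic_in_disc A ->
  is_solution A f1 -> is_solution A f2 ->
  (forall z, unit_disc z -> wronskian f1 f2 z = c) ->
  (forall z, unit_disc z -> Cmod (C_derive f1 z) * (1 - Cmod z ^ 2) <= M) ->
  (forall z, unit_disc z -> Cmod (C_derive f2 z) * (1 - Cmod z ^ 2) <= M) ->
  unit_disc z ->
  Cmod (A z) * Rpower (1 - Cmod z ^ 2) (5 / 2) <= 1568 / sqrt (Cmod c) * M.
Proof.
  move=> Hc HM HA [F1 [G1 S1]] [F2 [G2 S2]] HW B1 B2 Hz.
  have second : forall f, analytic_in_disc (C_derive f) ->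
      (forall z, unit_disc z -> (C_derive (C_derive f) z + A z * f z)%C = RtoC 0) ->
      derivative_in_disc (C_derive f) (fun w => - (A w * f w))%C.
  { move=> f G S w Hw.
    have -> : (- (A w * f w) = C_derive (C_derive f) w)%C.
    { have -> : (C_derive (C_derive f) w =
         (C_derive (C_derive f) w + A w * f w) - A w * f w)%C by ring.
      rewrite (S w Hw); ring. }
    exact: derivative_in_disc_C_derive G w Hw. }
  have Hz0 : 0 <= Cmod z by exact: Cmod_ge_0.
  have Hz1 : Cmod z < 1 by exact: Hz.
  have Hr : 0 < (1 - Cmod z) / 2 by lra.
  have Hdist : Cmod z + 2 * ((1 - Cmod z) / 2) <= 1 by lra.
  have key := solution_pair_bound c A _ f1 f2 _ _ z _ M Hc HM Hr Hdist
    (derivative_in_disc_C_derive A HA)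
    (derivative_in_disc_C_derive f1 F1) (derivative_in_disc_C_derive f2 F2)
    (second f1 G1 S1) (second f2 G2 S2) HW B1 B2.
  have Hc0 : 0 < Cmod c by apply/Cmod_gt_0.
  have Hs := sqrt_lt_R0 _ Hc0.
  have Hx : 0 < 1 - Cmod z ^ 2 by nra.
  have Hx5 : (1 - Cmod z ^ 2) ^ 5 <= (4 * ((1 - Cmod z) / 2)) ^ 5.
  { apply: pow_incr; split; nra. }
  apply: Rsqr_incr_0; last first.
  - apply: Rmult_le_pos; [apply: Rdiv_le_0_compat|]; lra.
  - apply: Rmult_le_pos; [exact: Cmod_ge_0|left; exact: exp_pos].
  - rewrite !Rsqr_pow2 (Rpow_mult_distr (Cmod (A z))) Rpower_5_2_sqr // -sqmod_Cmod.
    apply: (Rmult_le_reg_r (Cmod c)) => //.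
    have -> : (1568 / sqrt (Cmod c) * M) ^ 2 * Cmod c = 1024 * (2401 * M ^ 2).
    { rewrite -{2}(pow2_sqrt (Cmod c)); [field|]; lra. }
    have HAc : 0 <= sqmod (A z) * Cmod c by apply: Rmult_le_pos; [exact: sqmod_ge0|lra].
    have := Rmult_le_compat_l _ _ _ HAc Hx5. lra.
Qed.

Theorem theorem6 :
  forall c : C, c <> RtoC 0 ->
  exists K : R, 0 < K /\
  forall A f1 f2 : C -> C,
    analytic_in_disc A ->
    in_bloch f1 -> in_bloch f2 ->
    is_solution A f1 -> is_solution A f2 ->
    linearly_independent f1 f2 ->
    (forall z : C, unit_disc z -> wronskian f1 f2 z = c) ->
    Rbar_le
      (disc_sup (fun z : C => Cmod (A z) * Rpower (1 - Cmod z ^ 2) (5 / 2)))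
      (Rbar_mult (Finite K)
         (Rbar_max (bloch_seminorm f1) (bloch_seminorm f2))) /\
    Rbar_lt
      (Rbar_mult (Finite K)
         (Rbar_max (bloch_seminorm f1) (bloch_seminorm f2)))
      p_infty.
Proof.
  move=> c Hc.
  have Hc0 : 0 < Cmod c by apply/Cmod_gt_0.
  exists (1568 / sqrt (Cmod c)); split.
  { apply: Rdiv_lt_0_compat; [lra|exact: sqrt_lt_R0]. }
  move=> A f1 f2 HA [_ N1] [_ N2] Sol1 Sol2 _ HW.
  have [m1 [-> B1]] := bloch_seminorm_finite f1 N1.
  have [m2 [-> B2]] := bloch_seminorm_finite f2 N2.
  have [M [-> [Hm1 Hm2]]] : exists M : R,
      Rbar_max (Finite m1) (Finite m2) = Finite M /\ m1 <= M /\ m2 <= M.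
  { rewrite /Rbar_max; case: Rbar_le_dec => /= H.
    - by exists m2; split => //; split; [|lra].
    - by exists m1; split => //; split; lra. }
  (* the Wronskian at the origin forces a non-zero derivative there *)
  have HM : 0 < M.
  { have H0 : unit_disc (RtoC 0) by rewrite /unit_disc Cmod_0; lra.
    apply: Rnot_le_lt => HM.
    have vanish : forall f m, m <= M ->
        (forall z, unit_disc z -> Cmod (C_derive f z) * (1 - Cmod z ^ 2) <= m) ->
        C_derive f (RtoC 0) = RtoC 0.
    { move=> f m Hm B. apply: Cmod_eq_0. have := B _ H0. rewrite Cmod_0.
      have := Cmod_ge_0 (C_derive f (RtoC 0)). lra. }
    apply: Hc. rewrite -(HW _ H0) /wronskian (vanish f1 m1 Hm1 B1) (vanish f2 m2 Hm2 B2).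
    ring. }
  split=> //.
  have [_ Hlub] := Lub_Rbar_correct
    (fun x : R => exists z, unit_disc z /\ x = Cmod (A z) * Rpower (1 - Cmod z ^ 2) (5 / 2)).
  apply: Hlub => x [z [Hz ->]].
  apply: (solution_pair_pointwise c A f1 f2 M z) => // w Hw.
  - exact: Rle_trans (B1 w Hw) Hm1.
  - exact: Rle_trans (B2 w Hw) Hm2.
Qed.
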